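(* There is an $O(\ln n)$-approximation algorithm for Generalized $\beta$-Hopset when $\beta=2$.
   Context: Generalized $\beta$-Hopset: given a directed graph $G=(V,E)$ with $n=|V|$, edge lengths $\ell:E\to\{1,\dots,\mathrm{poly}(n)\}$, demand pairs $\mathcal{D}\subseteq V\times V$ and an arbitrary distance bound function $Dist:\mathcal{D}\to\mathbb{N}_{\ge 0}$, find a minimum-size set $H\subseteq\widetilde{E}$ such that every $(s,t)\in\mathcal{D}$ has an $s$–$t$ path in $G\cup H$ with at most $\beta$ edges and length at most $Dist(s,t)$. Here $\widetilde{E}=E_M\setminus E$, where $E_M$ is the edge set of the weighted transitive closure of $G$ ($(u,v)\in E_M$ iff $v$ is reachable from $u$, with length $d_G(u,v)$). An $\alpha$-approximation algorithm is a polynomial-time algorithm returning a feasible $H$ of size at most $\alpha$ times the optimum (possibly in expectation / with high probability for randomized algorithms). *)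

(* Defs.v *)
From HB Require Import structures.
From mathcomp Require Import all_boot all_order all_algebra.
From mathcomp Require Import all_classical all_reals all_analysis.

Set Implicit Arguments.
Unset Strict Implicit.
Unset Printing Implicit Defensive.

Import Order.TTheory GRing.Theory Num.Theory.
Import numFieldNormedType.Exports.

Local Open Scope nat_scope.

(** ** Generalized beta-hopsets *)

(* [len u v] is meaningful only when [edge u v], and [bound u v] only when
   [(u, v) \in demand]. *)
Record instance (V : finType) := Instance {
  edge : rel V;
  len : V -> V -> nat;
  demand : {set V * V};
  bound : V -> V -> nat }.

Definition lengths_within (lmax : {poly nat}) (V : finType) (I : instance V) :=
  forall u v, edge I u v -> 0 < len I u v <= lmax.[#|V|]%R.

(* A path from [s] is given by the sequence [p] of its vertices after [s], so
   that [size p] is its number of edges. *)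
Definition st_path (V : finType) (e : rel V) (s t : V) (p : seq V) :=
  path e s p && (last s p == t).

Definition path_length (V : finType) (w : V -> V -> nat) (s : V) (p : seq V) :=
  sumn (pairmap w s p).

Definition is_dist (V : finType) (I : instance V) (u v : V) (d : nat) : Prop :=
  (exists2 p, st_path (edge I) u v p & path_length (len I) u p = d) /\
  (forall p, st_path (edge I) u v p -> d <= path_length (len I) u p).

(* d_G; the value 0 taken when [v] is not reachable from [u] is never used. *)
Definition dG (V : finType) (I : instance V) (u v : V) : nat :=
  xget 0 (is_dist I u v).

Definition closure_edges (V : finType) (I : instance V) : {set V * V} :=
  [set e | connect (edge I) e.1 e.2].

Definition candidate_edges (V : finType) (I : instance V) : {set V * V} :=
  closure_edges I :\: [set e | edge I e.1 e.2].

Definition augmented_edge (V : finType) (I : instance V) (H : {set V * V}) :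
    rel V :=
  fun u v => edge I u v || ((u, v) \in H).

(* An edge of G keeps its own length, even when it exceeds d_G. *)
Definition augmented_len (V : finType) (I : instance V) (u v : V) : nat :=
  if edge I u v then len I u v else dG I u v.

Definition hopset (beta : nat) (V : finType) (I : instance V)
    (H : {set V * V}) : Prop :=
  H \subset candidate_edges I /\
  forall s t, (s, t) \in demand I ->
    exists p, [/\ st_path (augmented_edge I H) s t p,
                  size p <= beta
                & path_length (augmented_len I) s p <= bound I s t].

Definition minimum_hopset (beta : nat) (V : finType) (I : instance V)
    (H : {set V * V}) : Prop :=
  hopset beta I H /\ forall H', hopset beta I H' -> #|H| <= #|H'|.

(** ** Random access machine *)

(* The machine has finitely many arrays (those named in the program) of
   unboundedly many cells, each holding a natural number; [m a i] is the content
   of cell [i] of array [a], and a scalar variable is a cell with constant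
   index. Instructions have unit cost. As the only arithmetic operations are
   addition and truncated subtraction, a number computed in time t has at most
   t more bits than the numbers in the input and in the program, so that
   polynomial time on this machine is polynomial time on Turing machines. *)
Definition memory := nat -> nat -> nat.

Inductive expr :=
| Const of nat
| Read of nat & expr
| Add of expr & expr
| Sub of expr & expr.

Fixpoint eval (m : memory) (e : expr) : nat :=
  match e with
  | Const k => k
  | Read a e1 => m a (eval m e1)
  | Add e1 e2 => eval m e1 + eval m e2
  | Sub e1 e2 => eval m e1 - eval m e2
  end.

Fixpoint cost (e : expr) : nat :=
  match e with
  | Const _ => 1
  | Read _ e1 => (cost e1).+1
  | Add e1 e2 | Sub e1 e2 => (cost e1 + cost e2).+1
  end.

Inductive program :=
| Skip
| Write of nat & expr & expr
| Seq of program & program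
| If of expr & program & program
| While of expr & program.

Definition update (m : memory) (a i x : nat) : memory :=
  fun b j => if (b == a) && (j == i) then x else m b j.

(* [exec c m t m']: started in memory [m], the program [c] halts after time [t]
   in memory [m']. Tests succeed on nonzero values. *)
Inductive exec : program -> memory -> nat -> memory -> Prop :=
| ExecSkip m : exec Skip m 1 m
| ExecWrite m a ei ex :
    exec (Write a ei ex) m (cost ei + cost ex).+1
      (update m a (eval m ei) (eval m ex))
| ExecSeq c1 c2 m m1 m2 t1 t2 :
    exec c1 m t1 m1 -> exec c2 m1 t2 m2 -> exec (Seq c1 c2) m (t1 + t2) m2
| ExecIfTrue e c1 c2 m m1 t :
    eval m e != 0 -> exec c1 m t m1 -> exec (If e c1 c2) m (cost e + t).+1 m1
| ExecIfFalse e c1 c2 m m1 t :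
    eval m e = 0 -> exec c2 m t m1 -> exec (If e c1 c2) m (cost e + t).+1 m1
| ExecWhileFalse e c m :
    eval m e = 0 -> exec (While e c) m (cost e).+1 m
| ExecWhileTrue e c m m1 m2 t1 t2 :
    eval m e != 0 -> exec c m t1 m1 -> exec (While e c) m1 t2 m2 ->
    exec (While e c) m (cost e + t1 + t2).+1 m2.

(* The input is in array 0, the output is read from array 1. *)
Definition initial_memory (input : seq nat) : memory :=
  fun a i => if a == 0 then nth 0 input i else 0.

(* Total number of bits. *)
Definition input_size (input : seq nat) : nat :=
  \sum_(x <- input) (trunc_log 2 x).+1.

(** ** Approximation algorithms *)

(* The input consists of n and two n x n matrices in row-major order. Lengths
   being positive, 0 marks a missing edge in the first one; bounds are shifted
   by one in the second, where 0 marks a pair that is not a demand. *)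
Definition encode_instance (n : nat) (I : instance 'I_n) : seq nat :=
  n :: [seq (if edge I u v then len I u v else 0) | u <- enum 'I_n,
                                                    v <- enum 'I_n]
    ++ [seq (if (u, v) \in demand I then (bound I u v).+1 else 0)
         | u <- enum 'I_n, v <- enum 'I_n].

(* The output is the n x n adjacency matrix of H in row-major order. *)
Definition decode_output (n : nat) (m : memory) : {set 'I_n * 'I_n} :=
  [set e : 'I_n * 'I_n | m 1 (e.1 * n + e.2) != 0].

(* The algorithm must halt in polynomial time on every instance; if there is no
   hopset, its output is unconstrained. *)
Definition approximation_algorithm (R : realType) (beta : nat)
    (lmax : {poly nat}) (alpha : nat -> R) (prog : program) : Prop :=
  exists q : {poly nat}, forall (n : nat) (I : instance 'I_n),
    lengths_within lmax I ->
    exists (t : nat) (m : memory),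
      [/\ exec prog (initial_memory (encode_instance I)) t m,
          t <= q.[input_size (encode_instance I)]%R
        & forall Hopt, minimum_hopset beta I Hopt ->
            hopset beta I (decode_output n m) /\
            (#|decode_output n m|%:R <= alpha n * #|Hopt|%:R)%R].

(* Main.v *)
Require Import Defs.
From mathcomp Require Import all_boot all_order all_algebra.
From mathcomp Require Import all_classical all_reals all_analysis.
From mathcomp Require Import zify ring lra.
Import Order.TTheory GRing.Theory Num.Theory.
Import numFieldNormedType.Exports.
Import fintype boot.finset.
Import Defs.

Set Implicit Arguments.
Unset Strict Implicit.
Unset Printing Implicit Defensive.

(** A demand (s, t) is served by a midpoint w when both steps (s, w) and (w, t)
    are free (trivial, or edges of G) or belong to H. For a threshold d
    decreasing to 1 and each midpoint w in turn, peel off non-free steps until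
    each remaining one lies on at least d uncovered demands served through w by
    remaining steps; add the surviving steps to H and mark those demands
    covered. A demand uses at most two steps, so d times the number of steps
    added is at most twice the number of demands covered. Once peeling for d + 1
    leaves no uncovered demand at any midpoint, every hopset H' satisfies
    |uncovered| <= 2 d |H'|: a step set containing k non-free steps serves at
    most d k of these demands through w (peel it completely), and each step of
    H' counts for two midpoints. Summing over d gives
    |H| <= 4 |H'| (1 + 1/2 + 1/3 + ...). *)

(** * A language of bounded loops *)

(** Greedy covering would have to choose the best star at a midpoint [w], and there are
    exponentially many. Take the steps at [w] as vertices and let a demand (s, t) be an edge joining
    (s, w) to (w, t): the best star is then a densest subgraph, and peeling low degrees is the
    classical 2-approximation for it. Free steps are vertices of cost zero, so they are never
    peeled. Fixed integer thresholds replace the comparison of densities, which suits a machine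
    without multiplication or division. The scheme works because the length of a step between two
    given vertices does not depend on H: an edge of G keeps its own length, and any other pair can
    only be added with length d_G. Which midpoints can serve a demand is thus settled before H is
    chosen. The factor 4 is a product of two losses of 2: an edge has two ends, and a step (a, b)
    belongs to the stars of both a and b. Starting the thresholds above n^2 costs only a constant,
    as ln(n^2) = 2 ln n. *)

(* [For k b s] runs [s] with the counter [m k 0] ranging over
   [0, ..., n + b - 1], where [n = m 0 0]. Bounded loops make the
   semantics a total function, and the running time a polynomial in [n] defined
   by recursion on the syntax. *)
Inductive stmt :=
| Assign of nat & expr & expr
| Then of stmt & stmt
| Cond of expr & stmt
| For of nat & nat & stmt.

Fixpoint sem (s : stmt) (m : memory) : memory :=
  match s with
  | Assign a i x => update m a (eval m i) (eval m x)
  | Then s1 s2 => sem s2 (sem s1 m)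
  | Cond e s1 => if eval m e != 0 then sem s1 m else m
  | For k b s1 =>
      update (foldl (fun m1 i => sem s1 (update m1 k 0 i)) m
                    (iota 0 (m 0 0 + b)))
             k 0 (m 0 0 + b)
  end.

Fixpoint compile (s : stmt) : program :=
  match s with
  | Assign a i x => Write a i x
  | Then s1 s2 => Seq (compile s1) (compile s2)
  | Cond e s1 => If e (compile s1) Skip
  | For k b s1 =>
      Seq (Write k (Const 0) (Const 0))
        (While (Sub (Add (Read 0 (Const 0)) (Const b)) (Read k (Const 0)))
          (Seq (compile s1)
             (Write k (Const 0) (Add (Read k (Const 0)) (Const 1)))))
  end.

Fixpoint writes (s : stmt) : seq nat :=
  match s with
  | Assign a _ _ => [:: a]
  | Then s1 s2 => writes s1 ++ writes s2
  | Cond _ s1 => writes s1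
  | For k _ s1 => k :: writes s1
  end.

Fixpoint counters_ok (s : stmt) : bool :=
  match s with
  | Assign _ _ _ => true
  | Then s1 s2 => counters_ok s1 && counters_ok s2
  | Cond _ s1 => counters_ok s1
  | For k _ s1 => (k \notin writes s1) && counters_ok s1
  end.

(** Array 0 is never written, so n stays fixed, and no loop body writes the counter of its loop.
    These two facts make the compiled [While] follow the fold over [iota]. *)
Definition well_formed (s : stmt) := (0 \notin writes s) && counters_ok s.

Fixpoint time (s : stmt) : {poly nat} :=
  match s with
  | Assign _ i x => ((cost i + cost x).+1)%:P
  | Then s1 s2 => time s1 + time s2
  | Cond e s1 => ((cost e).+2)%:P + time s1
  | For _ b s1 => 15%:P + ('X + b%:P) * (time s1 + 15%:P)
  end%R.

Lemma update_same m a i x : update m a i x a i = x.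
Proof. by rewrite /update !eqxx. Qed.

Lemma update_other m a i x b : b != a -> update m a i x b = m b.
Proof. by move=> /negbTE ba; apply: funext => j; rewrite /update ba. Qed.

Lemma update_id m a i : update m a i (m a i) = m.
Proof.
apply: funext => b; apply: funext => j; rewrite /update.
by case: andP => // -[/eqP-> /eqP->].
Qed.

Lemma update_update m a i x y : update (update m a i x) a i y = update m a i y.
Proof.
by apply: funext => b; apply: funext => j; rewrite /update; case: (_ && _).
Qed.

Lemma sem_assign a i x m :
  sem (Assign a i x) m = update m a (eval m i) (eval m x).
Proof. by []. Qed.

Lemma sem_then s1 s2 m : sem (Then s1 s2) m = sem s2 (sem s1 m).
Proof. by []. Qed.

Lemma sem_cond e s m :
  sem (Cond e s) m = if eval m e != 0 then sem s m else m.
Proof. by []. Qed.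

Lemma sem_frame s m a : a \notin writes s -> sem s m a = m a.
Proof.
elim: s m => [b i x|s1 IH1 s2 IH2|e s1 IH|k b s1 IH] m /=.
- by rewrite inE => ab; rewrite update_other.
- by rewrite mem_cat negb_or => /andP[a1 a2]; rewrite IH2 // IH1.
- by move=> a1; case: ifP => // _; rewrite IH.
- rewrite inE negb_or => /andP[ak a1]; rewrite update_other //.
  move: (iota _ _) => r; elim: r m => //= i r IHr m.
  by rewrite IHr IH // update_other.
Qed.

Lemma horner_nat (p q : {poly nat}) (x : nat) :
  ((p + q).[x] = (p.[x] + q.[x])%N)%R /\ ((p * q).[x] = (p.[x] * q.[x])%N)%R.
Proof. by rewrite hornerD hornerM. Qed.

Lemma exec_compile s m N :
  well_formed s -> m 0 0 <= N ->
  exists2 t, exec (compile s) m t (sem s m) & t <= (time s).[N]%R.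
Proof.
rewrite /well_formed.
elim: s m => [b i x|s1 IH1 s2 IH2|e s1 IH|k b s1 IH] m /=.
- by move=> _ _; exists (cost i + cost x).+1; [constructor | rewrite hornerC].
- rewrite mem_cat negb_or => /andP[/andP[w1 w2] /andP[c1 c2]] mN.
  have [|//|t1 e1 l1] := IH1 m; first by rewrite w1.
  have [||t2 e2 l2] := IH2 (sem s1 m); [by rewrite w2|by rewrite sem_frame|].
  exists (t1 + t2); first by apply: ExecSeq e1 e2.
  by rewrite (horner_nat _ _ _).1 leq_add.
- move=> wf mN; case: ifP => [eT|/negbFE/eqP eF].
    have [//|//|t1 e1 l1] := IH m.
    exists (cost e + t1).+1; first exact: ExecIfTrue.
    rewrite (horner_nat _ _ _).1 hornerC; lia.
  exists (cost e + 1).+1.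
    by apply: ExecIfFalse => //; constructor.
  by rewrite (horner_nat _ _ _).1 hornerC addn1 leq_addr.
- rewrite inE negb_or => /andP[/andP[k0 w0] /andP[kw c1]] mN.
  rewrite (horner_nat _ _ _).1 (horner_nat _ _ _).2 !(horner_nat _ _ _).1
    !hornerC hornerX.
  set L := While _ _; set B := m 0 0 + b.
  have fold_upd l m2 x :
      update (foldl (fun m1 i => sem s1 (update m1 k 0 i))
                    (update m2 k 0 x) l) k 0 B =
      update (foldl (fun m1 i => sem s1 (update m1 k 0 i)) m2 l) k 0 B.
    by case: l => [|j l] /=; rewrite update_update.
  have loop r i m1 : m1 0 0 = m 0 0 -> m1 k 0 = i -> i + r = B ->
    exists2 t, exec L m1 t
        (update (foldl (fun m1 i => sem s1 (update m1 k 0 i)) m1 (iota i r))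
                k 0 B)
      & t <= 9 + r * ((time s1).[N]%R + 15).
    elim: r i m1 => [|r IHr] i m1 m10 m1k ir.
      exists 8 => //=.
      rewrite -ir addn0 -m1k update_id.
      by apply: ExecWhileFalse; rewrite /= m10 m1k; apply/eqP;
        rewrite subn_eq0; lia.
    have [|//|t1 e1 l1] := IH m1; first by rewrite w0.
      by rewrite m10.
    have sk : sem s1 m1 k = m1 k by rewrite sem_frame.
    have s0 : sem s1 m1 0 = m1 0 by rewrite sem_frame.
    have [|||t2 e2 l2] := IHr i.+1 (update (sem s1 m1) k 0 i.+1).
    + by rewrite update_other ?s0 // eq_sym.
    + by rewrite update_same.
    + by rewrite addSnnS.
    (* The loop test costs 7 and the increment of the counter costs 6. *)
    exists (7 + (t1 + 6) + t2).+1; last by rewrite mulSn; lia.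
    rewrite /= -{1}m1k update_id.
    apply: (@ExecWhileTrue _ _ _ (update (sem s1 m1) k 0 i.+1)).
    + rewrite /= m10 m1k -/B; lia.
    + apply: ExecSeq e1 _; have :=
        ExecWrite (sem s1 m1) k (Const 0) (Add (Read k (Const 0)) (Const 1)).
      by rewrite /= sk m1k [i + 1]addn1.
    + by rewrite /= fold_upd in e2.
  have [||//|t e l] := loop B 0 (update m k 0 0).
  - by rewrite update_other // eq_sym.
  - by rewrite update_same.
  exists (3 + t).
    apply: ExecSeq; first exact: ExecWrite.
    by rewrite -(fold_upd _ _ 0).
  have : B * ((time s1).[N]%R + 15) <= (N + b) * ((time s1).[N]%R + 15).
    by rewrite leq_mul2r leq_add2r mN orbT.
  lia.
Qed.

(** [P] must survive any write to the counter, because [For] sets it before each iteration and once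
    more at the end. *)
Lemma for_ind (P : nat -> memory -> Prop) k b s m :
  (forall i x m1, P i m1 -> P i (update m1 k 0 x)) ->
  P 0 m ->
  (forall i m1, i < m 0 0 + b -> m1 k 0 = i -> P i m1 -> P i.+1 (sem s m1)) ->
  P (m 0 0 + b) (sem (For k b s) m).
Proof.
move=> Pk P0 /=; move: (m 0 0 + b) => N Ps; apply: (Pk).
have loop r i m1 : i + r = N -> P i m1 ->
    P N (foldl (fun m2 j => sem s (update m2 k 0 j)) m1 (iota i r)).
  elim: r i m1 => [|r IHr] i m1 irN Pi /=; first by rewrite -irN addn0.
  apply: IHr; first by rewrite addSnnS.
  by apply: Ps; [lia | rewrite update_same | exact: Pk].
exact: loop.
Qed.

(* Order-free loop rule: each iteration establishes its own [Q i] and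
   destroys none of those already established. *)
Lemma for_all (Inv : memory -> Prop) (Q : nat -> memory -> Prop) k b s m :
  (forall x m1, Inv m1 -> Inv (update m1 k 0 x)) ->
  (forall i x m1, Q i m1 -> Q i (update m1 k 0 x)) ->
  Inv m ->
  (forall i m1, i < m 0 0 + b -> m1 k 0 = i -> Inv m1 ->
    [/\ Inv (sem s m1), Q i (sem s m1)
      & forall j, j < m 0 0 + b -> Q j m1 -> Q j (sem s m1)]) ->
  Inv (sem (For k b s) m) /\
  forall i, i < m 0 0 + b -> Q i (sem (For k b s) m).
Proof.
move=> Ik Qk I0 step; set N := m 0 0 + b.
pose P i m1 := Inv m1 /\ forall j, j < i -> j < N -> Q j m1.
suff [I1 Q1] : P N (sem (For k b s) m) by split=> // i iN; exact: Q1.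
apply: for_ind => [i x m1 [I1 Q1]|//|i m1 iN mi [I1 Q1]].
  by split=> [|j ji jN]; [exact: Ik | apply: Qk; exact: Q1].
have [I2 Qi Q2] := step i m1 iN mi I1.
split=> // j; rewrite ltnS leq_eqVlt => /orP[/eqP-> //|ji] jN.
by apply: Q2 => //; apply: Q1.
Qed.

Lemma for2_all (Inv : memory -> Prop) (Q : nat -> nat -> memory -> Prop)
    k1 k2 s m n :
  m 0 0 = n ->
  k1 != k2 -> k1 \notin writes s ->
  (forall x k m1, k \in [:: k1; k2] -> Inv m1 -> Inv (update m1 k 0 x)) ->
  (forall i j x k m1, k \in [:: k1; k2] -> Q i j m1 ->
    Q i j (update m1 k 0 x)) ->
  (forall m1, Inv m1 -> m1 0 0 = n) ->
  Inv m ->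
  (forall i j m1, i < n -> j < n -> m1 k1 0 = i -> m1 k2 0 = j -> Inv m1 ->
    [/\ Inv (sem s m1), Q i j (sem s m1)
      & forall i' j', i' < n -> j' < n -> Q i' j' m1 -> Q i' j' (sem s m1)]) ->
  Inv (sem (For k1 0 (For k2 0 s)) m) /\
  forall i j, i < n -> j < n -> Q i j (sem (For k1 0 (For k2 0 s)) m).
Proof.
move=> m0 k12 k1s Ik Qk I0 Im step.
have k1in : k1 \in [:: k1; k2] by rewrite inE eqxx.
have k2in : k2 \in [:: k1; k2] by rewrite !inE eqxx orbT.
pose Q1 i m1 := forall j, j < n -> Q i j m1.
have [] := @for_all Inv Q1 k1 0 (For k2 0 s) m.
- by move=> x m1; exact: Ik.
- by move=> i x m1 Qi j jn; apply: Qk => //; exact: Qi.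
- by [].
- rewrite m0 addn0 => i m1 iN mi I1.
  pose Inv2 m2 := [/\ Inv m2, m2 k1 0 = i &
    forall i' j', i' < n -> j' < n -> Q i' j' m1 -> Q i' j' m2].
  have [] := @for_all Inv2 (Q i) k2 0 s m1.
  + move=> x m2 [I2 mi2 Q2]; split; [exact: Ik|by rewrite update_other|].
    by move=> i' j' i'n j'n Q'; apply: Qk => //; exact: Q2.
  + by move=> j x m2; exact: Qk.
  + by [].
  + rewrite (I0 _ I1) addn0 => j m2 jn mj [I2 mi2 Q2].
    have [I3 Q3 Q4] := step i j m2 iN jn mi2 mj I2.
    split=> //; last by move=> j' j'n Q'; apply: Q4.
    split=> //; first by rewrite sem_frame.
    by move=> i' j' i'n j'n Q'; apply: Q4 => //; apply: Q2.
  + rewrite (I0 _ I1) addn0 => -[I2 _ Q2] Q3.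
    split=> // j jn Qj j' j'n; apply: Q2 => //; exact: Qj.
- rewrite m0 addn0 => I1 Q2; split=> // i j iN jn; exact: Q2.
Qed.

(** * Filling and counting in row-major matrices *)

Definition var k := Read k (Const 0).
Definition cell x y := Add (Read 2 x) y.
Definition entry a x y := Read a (cell x y).

(** Row n is included: [n * n] is the offset at which [boundE] finds the second matrix of the
    input. *)
Definition row_table n (m : memory) :=
  m 0 0 = n /\ forall i, i <= n -> m 2 i = i * n.

Definition agree_off (l : seq nat) (m m1 : memory) :=
  forall c, c \notin l -> m1 c = m c.

Lemma agree_off_update l m m1 c x y :
  c \in l -> agree_off l m m1 -> agree_off l m (update m1 c x y).
Proof.
move=> cl mm b bl; rewrite update_other ?mm //.
by apply: contraNneq bl => ->.
Qed.

Lemma agree_off_sem l m m1 s :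
  all (mem l) (writes s) -> agree_off l m m1 -> agree_off l m (sem s m1).
Proof.
move=> /allP sl mm b bl; rewrite sem_frame ?mm //.
by apply: contra bl => /sl.
Qed.

Lemma agree_off_row_table n l m m1 :
  0 \notin l -> 2 \notin l -> agree_off l m m1 ->
  row_table n m -> row_table n m1.
Proof. by move=> l0 l2 mm [m0 mr]; rewrite /row_table !mm. Qed.

Definition fill a e x :=
  For 10 0 (For 11 0 (Cond e (Assign a (cell (var 10) (var 11)) x))).

Lemma cell_inj n i j i' j' : j < n -> j' < n ->
  (i * n + j == i' * n + j') = (i == i') && (j == j').
Proof.
move=> jn j'n; apply/eqP/andP => [E|[/eqP-> /eqP->]] //.
have n0 : 0 < n by lia.
have ei : i = i'.
  by have := congr1 (divn^~ n) E; rewrite !divnMDl // !divn_small // !addn0.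
by rewrite ei in E *; move/addnI: E => ->.
Qed.

(** The hypothesis on [e] and [x] leaves array [a] arbitrary, since earlier iterations may already
    have changed it. *)
Lemma fill_spec n m a e x (b : nat -> nat -> bool) (v : nat -> nat -> nat) :
  row_table n m -> a \notin [:: 0; 2; 10; 11] ->
  (forall m1 i j, i < n -> j < n -> m1 10 0 = i -> m1 11 0 = j ->
     agree_off [:: a; 10; 11] m m1 ->
     (eval m1 e != 0) = b i j /\ (b i j -> eval m1 x = v i j)) ->
  forall i j, i < n -> j < n ->
    sem (fill a e x) m a (i * n + j) =
      if b i j then v i j else m a (i * n + j).
Proof.
move=> rm an ev; set L := [:: a; 10; 11].
have rL m1 : agree_off L m m1 -> row_table n m1.
  move=> mm; apply: agree_off_row_table mm rm;
    by apply: contra an; rewrite !inE => /or3P[/eqP<-|//|//].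
pose fin i j m1 :=
  m1 a (i * n + j) = if b i j then v i j else m a (i * n + j).
have a10 k : k \in [:: 10; 11] -> a != k.
  by move=> k1; apply: contraNneq an => ->; move: k1; rewrite !inE => /orP[]->;
    rewrite ?orbT.
(* Each cell holds its old or its final value. If [b i j] fails the two coincide, so skipping the
   assignment is correct. *)
pose Inv m1 := agree_off L m m1 /\ forall i j, i < n -> j < n ->
  m1 a (i * n + j) = m a (i * n + j) \/ fin i j m1.
have [] := @for2_all Inv fin 10 11
  (Cond e (Assign a (cell (var 10) (var 11)) x)) m n.
- by case: rm.
- by [].
- by rewrite /= inE eq_sym a10.
- move=> y k m1 kin [ma mf]; split.
    by apply: agree_off_update => //; move: kin; rewrite !inE => /orP[]->;
      rewrite ?orbT.
  by move=> i j iN jn; rewrite /fin update_other ?a10 //; exact: mf.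
- by move=> i j y k m1 kin; rewrite /fin update_other ?a10.
- by move=> m1 [/rL[]].
- by split=> // i j _ _; left.
- move=> i j m1 iN jn mi mj [ma mf].
  have [ee ex] := ev m1 i j iN jn mi mj ma.
  rewrite /= mi mj ee; case: ifP => bij; last first.
    split=> //; case: (mf i j iN jn) => //.
    by rewrite /fin bij.
  have [_ ->] := rL _ ma; last exact: ltnW.
  rewrite ex // /Inv /fin.
  have upd i' j' : j' < n -> update m1 a (i * n + j) (v i j) a (i' * n + j') =
     if (i == i') && (j == j') then v i j else m1 a (i' * n + j').
    by move=> j'n; rewrite /update eqxx /= cell_inj // (eq_sym i) (eq_sym j).
  split.
  + split; first by apply: agree_off_update; rewrite // inE eqxx.
    move=> i' j' i'n j'n; rewrite upd //; case: andP => [[/eqP<- /eqP<-]|_].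
      by right; rewrite bij.
    exact: mf.
  + by rewrite upd // !eqxx bij.
  + move=> i' j' i'n j'n E; rewrite upd //.
    by case: andP => // -[/eqP<- /eqP<-]; rewrite bij.
- by move=> _ Q i j iN jn; exact: Q.
Qed.

Definition count_pairs e :=
  Then (Assign 8 (Const 0) (Const 0))
    (For 12 0 (For 13 0 (Cond e (Assign 8 (Const 0) (Add (var 8) (Const 1)))))).

Lemma count_pairs_spec n m e (b : nat -> nat -> bool) :
  m 0 0 = n ->
  (forall m1 i j, i < n -> j < n -> m1 12 0 = i -> m1 13 0 = j ->
     agree_off [:: 8; 12; 13] m m1 -> (eval m1 e != 0) = b i j) ->
  sem (count_pairs e) m 8 0 = #|[set p : 'I_n * 'I_n | b p.1 p.2]|.
Proof.
move=> m0 ev; rewrite /count_pairs; set body := Cond _ _.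
change (sem (For 12 0 (For 13 0 body)) (update m 8 0 0) 8 0 =
  #|[set p : 'I_n * 'I_n | b p.1 p.2]|).
set L := [:: 8; 12; 13].
pose P i m1 := agree_off L m m1 /\ m1 8 0 =
  \sum_(0 <= i' < i) \sum_(0 <= j < n) b i' j.
have := @for_ind P 12 0 (For 13 0 body) (update m 8 0 0).
have -> : update m 8 0 0 0 0 + 0 = n by rewrite addn0 update_other.
case.
- move=> i x m1 [ma ms]; split; first exact: agree_off_update.
  by rewrite update_other.
- by split; [apply: agree_off_update | rewrite big_geq].
- move=> i m1 iN mi [ma ms].
  pose P2 j m2 := [/\ agree_off L m m2, m2 12 0 = i &
     m2 8 0 = m1 8 0 + \sum_(0 <= j' < j) b i j'].
  have := @for_ind P2 13 0 body m1.
  rewrite addn0 ma // m0 => -[].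
  + move=> j x m2 [ma2 mi2 ms2].
    by split; [exact: agree_off_update| rewrite update_other
             |rewrite update_other].
  + by split => //; rewrite big_geq // addn0.
  + move=> j m2 jn mj [ma2 mi2 ms2]; rewrite /P2 big_nat_recr //= addnA -ms2.
    rewrite (ev m2 i j) //; case: ifP => _; rewrite ?addn0 //.
    by split; [exact: agree_off_update|rewrite update_other
             |rewrite update_same].
  + by move=> ma2 _ E; split=> //; rewrite E big_nat_recr //= ms.
- move=> _ ->; rewrite big_mkord.
  under eq_bigr do rewrite big_mkord.
  rewrite pair_bigA -sum1dep_card [RHS]big_mkcond /=.
  by apply: eq_bigr => p _; case: (b _ _).
Qed.

(** * Peeling the steps around a midpoint *)

Lemma sum_indicator (T : finType) (a : T) : \sum_x (x == a) = 1.
Proof. by rewrite (bigD1 a) //= eqxx big1 // => x /negbTE->. Qed.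

Section Stars.

Variables (V : finType) (valid : V -> V * V -> bool) (free : {set V * V}).
Implicit Types (w : V) (p e : V * V) (U K S H : {set V * V}).

Definition uses w p e := (e == (p.1, w)) || (e == (w, p.2)).

Definition live w U K :=
  [set p in U | [&& valid w p, (p.1, w) \in K & (w, p.2) \in K]].

Definition load w U K e := #|[set p in live w U K | uses w p e]|.

(** The condition defining a d-core in the graph whose edges are the live demands, with free steps
    exempt from the degree bound. *)
Definition stable d w U K :=
  forall e, e \in K -> e \notin free -> d <= load w U K e.

(** Quantifying over every stable [K], not only the one computed, lets the property pass to smaller
    [U], so the work on later midpoints preserves it. A set of free steps is always stable, hence no
    demand of [U] is then served through [w] by free steps alone. *)
Definition exhausted d w U := forall K, stable d w U K -> live w U K = set0.

Lemma live_sub w U U' K K' :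
  U \subset U' -> K \subset K' -> live w U K \subset live w U' K'.
Proof.
move=> /subsetP UU /subsetP KK; apply/subsetP => p; rewrite !inE.
by case/andP => /UU-> /and3P[-> /KK-> /KK->].
Qed.

Lemma load_sub w U U' K K' e :
  U \subset U' -> K \subset K' -> load w U K e <= load w U' K' e.
Proof.
move=> /subsetP UU /subsetP KK; apply: subset_leq_card; apply/subsetP => p.
by rewrite !inE => /andP[/andP[/UU-> /and3P[-> /KK-> /KK->]] ->].
Qed.

Lemma stable_load d w U S K e : stable d w U S -> S \subset K ->
  e \in S -> e \notin free -> d <= load w U K e.
Proof.
by move=> sS SK eS ef; apply: leq_trans (sS e eS ef) (load_sub _ _ _ SK).
Qed.

Lemma stable_cost d w U K :
  stable d w U K -> d * #|K :\: free| <= 2 * #|live w U K|.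
Proof.
move=> sK; rewrite mulnC -sum_nat_const.
apply: (@leq_trans (\sum_(e in K :\: free) \sum_(p in live w U K) uses w p e)).
  apply: leq_sum => e; rewrite inE => /andP[ef eK].
  apply: leq_trans (sK e eK ef) _.
  rewrite /load -sum1_card big_mkcond [leqRHS]big_mkcond /=.
  by apply: leq_sum => p _; rewrite in_set; case: (p \in _); case: (uses _ _ _).
rewrite exchange_big /= mulnC -sum_nat_const leq_sum // => p _.
apply: (@leq_trans (\sum_e ((e == (p.1, w)) + (e == (w, p.2))))).
  rewrite [leqLHS]big_mkcond /=; apply: leq_sum => e _.
  by rewrite /uses; case: ifP => //; case: eqP; case: eqP.
by rewrite big_split /= !sum_indicator.
Qed.

Lemma exhausted_sub d w U U' :
  U' \subset U -> exhausted d w U -> exhausted d w U'.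
Proof.
move=> UU xU K sK; apply/eqP; rewrite -subset0 -(xU K).
  exact: live_sub.
by move=> e eK ef; apply: leq_trans (sK e eK ef) (load_sub _ _ UU _).
Qed.

(** A set that is stable for the remaining demands is stable for [U], hence contained in [K], so
    whatever it serves was removed with the demands live in [K]. *)
Lemma maximal_exhausted d w U K :
  (forall S, stable d w U S -> S \subset K) ->
  exhausted d w (U :\: live w U K).
Proof.
move=> mK S sS.
have sS' : stable d w U S.
  move=> e eS ef; apply: leq_trans (sS e eS ef) (load_sub _ _ _ _) => //.
  exact: subsetDl.
have /subsetP lSK := live_sub w (subxx U) (mK S sS').
apply/setP => p; rewrite [RHS]inE; apply/negP => pl.
have : p \in live w U K.
  by apply: lSK; have /subsetP :=
    live_sub w (subsetDl U (live w U K)) (subxx S); apply.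
by move: pl; rewrite in_set in_setD => /andP[/andP[/negP]].
Qed.

Lemma exhausted_live d w U K :
  exhausted d.+1 w U -> #|live w U K| <= d * #|K :\: free|.
Proof.
move=> xU; move: {2}#|_| (leqnn #|K :\: free|) => n.
elim: n K => [|n IHn] K Kn.
  rewrite xU ?cards0 // => e eK ef.
  have : K :\: free = set0 by apply/eqP; rewrite -cards_eq0; lia.
  by move/setP/(_ e); rewrite !inE eK ef.
have [/forallP sK|] := boolP [forall e, (e \in K) ==> (e \notin free) ==>
  (d < load w U K e)].
  rewrite xU ?cards0 // => e eK ef.
  by have /implyP/(_ eK)/implyP/(_ ef) := sK e.
rewrite negb_forall => /existsP[e].
rewrite !negb_imply -leqNgt => /and3P[eK ef ld].
have E : (K :\ e) :\: free = (K :\: free) :\ e.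
  by apply/setP => x; rewrite !inE; case: (x == e); rewrite ?andbF.
have cE : #|K :\: free| = (#|(K :\ e) :\: free|).+1.
  by rewrite E (cardsD1 e) !inE ef eK.
(* Dropping [e] loses only the demands that use it, at most [d] of them. *)
apply: (@leq_trans (#|live w U (K :\ e)| + load w U K e)).
  apply: leq_trans (leq_card_setU _ _).
  apply: subset_leq_card; apply/subsetP => p pl.
  move: pl; rewrite !inE => /andP[-> /and3P[-> -> ->]].
  by rewrite /uses !andbT !(eq_sym e); case: eqP; case: eqP.
rewrite cE mulnS addnC leq_add // IHn //.
by rewrite cE in Kn.
Qed.

Lemma exhausted_bound d U H :
  (forall w, exhausted d.+1 w U) ->
  (forall p, p \in U -> exists w,
     [&& valid w p, (p.1, w) \in free :|: H & (w, p.2) \in free :|: H]) ->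
  #|U| <= 2 * d * #|H|.
Proof.
move=> xU cov.
(* A step (a, b) of [H] can act only around its own ends: as a second half when w = a and as a first
   half when w = b. *)
pose K w := free :|: [set e in H | (w == e.1) || (w == e.2)].
have cK w : #|K w :\: free| <= \sum_(e in H) ((w == e.1) + (w == e.2)).
  rewrite -sum1_card [leqLHS]big_mkcond [leqRHS]big_mkcond /=.
  apply: leq_sum => e _; rewrite !inE; case: (e \in free) => //=.
  by case: (e \in H) => //=; case: eqP; case: eqP.
have UK : #|U| <= \sum_w #|live w U (K w)|.
  apply: (@leq_trans (\sum_(p in U) \sum_w (p \in live w U (K w)))).
    rewrite -sum1_card; apply: leq_sum => p pU.
    have [w /and3P[v h1 h2]] := cov p pU.
    rewrite (bigD1 w) //= in_set pU v /=.
    by move: h1 h2; rewrite !in_setU !in_set /= !eqxx orbT !andbT => -> ->.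
  rewrite exchange_big /=; apply: leq_sum => w _.
  rewrite -sum1_card big_mkcond [leqRHS]big_mkcond /=.
  by apply: leq_sum => p _; case: (p \in U) => //; case: (p \in live _ _ _).
apply: leq_trans UK _.
apply: (@leq_trans (\sum_w d * \sum_(e in H) ((w == e.1) + (w == e.2)))).
  apply: leq_sum => w _; apply: leq_trans (exhausted_live _ (xU w)) _.
  by rewrite leq_mul2l cK orbT.
rewrite -big_distrr /= exchange_big /= [2 * d]mulnC -mulnA leq_mul2l;
  apply/orP; right.
rewrite mulnC -sum_nat_const leq_sum // => e _.
by rewrite big_split /= !sum_indicator.
Qed.

End Stars.

(** * Walks and hopsets *)

Section Walks.

Variables (V : finType) (I : instance V).
Implicit Types (u v w s t : V) (p q : seq V) (H : {set V * V}).

Lemma path_length_cat (f : V -> V -> nat) u p q :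
  path_length f u (p ++ q) = path_length f u p + path_length f (last u p) q.
Proof. by rewrite /path_length pairmap_cat sumn_cat. Qed.

(** Loop erasure: when the starting vertex recurs, the walk is replaced by its part after that
    recurrence. Lengths are natural numbers, so dropping a prefix never makes it longer. *)
Lemma uniq_walk (e : rel V) (f : V -> V -> nat) u v p :
  st_path e u v p -> exists2 q, st_path e u v q &
    uniq (u :: q) /\ path_length f u q <= path_length f u p.
Proof.
elim: p u => [|x p IHp] u; first by exists [::].
rewrite /st_path /= => /andP[/andP[ux px] lx].
have [|q /andP[pq lq] [uq le]] := IHp x; first by rewrite /st_path px.
have [uin|unin] := boolP (u \in x :: q); last first.
  exists (x :: q); first by rewrite /st_path /= ux pq.
  by split; [rewrite cons_uniq unin | rewrite /path_length /= leq_add2l].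
move: uin pq lq uq le => /splitPl[q1 q2 lq1].
rewrite cat_path last_cat lq1 => /andP[pq1 pq2] lq2 uq le.
exists q2; first by rewrite /st_path pq2 lq2.
split.
  move: uq; rewrite -cat_cons cat_uniq => /and3P[_ /hasPn nq uq2].
  apply/andP; split=> //; apply/negP => /nq.
  by rewrite -[u in u \in _]lq1 mem_last.
rewrite /path_length /=; apply: leq_trans (leq_addl _ _).
by apply: leq_trans le; rewrite path_length_cat lq1 leq_addl.
Qed.

Lemma short_walk (e : rel V) (f : V -> V -> nat) u v p :
  st_path e u v p -> exists2 q, st_path e u v q &
    size q < #|V| /\ path_length f u q <= path_length f u p.
Proof.
case/(uniq_walk f) => q q1 [uq ql]; exists q => //; split=> //.
by rewrite -/(size (u :: q)) -(card_uniqP uq) max_card.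
Qed.

Lemma connect_st_path u v :
  connect (edge I) u v <-> exists p, st_path (edge I) u v p.
Proof.
split=> [/connectP[p pp ->]|[p /andP[pp /eqP<-]]].
  by exists p; rewrite /st_path pp eqxx.
by apply/connectP; exists p.
Qed.

Lemma dG_eq u v d : is_dist I u v d -> dG I u v = d.
Proof.
move=> [[p pp pd] dmin]; apply: xget_unique; first by split=> //; exists p.
move=> d' [[p' pp' pd'] dmin']; apply/eqP; rewrite eqn_leq.
by rewrite -{1}pd dmin' //= -pd' dmin.
Qed.

(** The diagonal is 0 even where G has a loop of positive length: a path with fewer than two edges
    is padded with trivial steps at no cost. *)
Definition step_len u v := if u == v then 0 else augmented_len I u v.

Definition free_steps : {set V * V} := [set e | (e.1 == e.2) || edge I e.1 e.2].

(** Requiring reachability of both halves ensures that non-free steps taken from served demands are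
    candidate edges. *)
Definition midpoint w (p : V * V) :=
  [&& connect (edge I) p.1 w, connect (edge I) w p.2
    & step_len p.1 w + step_len w p.2 <= bound I p.1 p.2].

Lemma step_len_le u v : step_len u v <= augmented_len I u v.
Proof. by rewrite /step_len; case: ifP. Qed.

Lemma hopset_midpoint H (p : V * V) : hopset 2 I H -> p \in demand I ->
  exists w, [&& midpoint w p, (p.1, w) \in free_steps :|: H
              & (w, p.2) \in free_steps :|: H].
Proof.
case: p => s t [HC HD] /HD[p []] /=.
have conn u v : augmented_edge I H u v ->
    connect (edge I) u v && ((u, v) \in free_steps :|: H).
  case/orP => [uv|uvH].
    by rewrite connect1 // !inE uv orbT.
  by move/subsetP/(_ _ uvH): HC; rewrite !inE => /andP[_ ->]; rewrite uvH orbT.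
have refl u : (u, u) \in free_steps :|: H by rewrite !inE eqxx.
(* A path with no edge takes the midpoint s, one edge takes t, two edges take the middle vertex. *)
case: p => [|w [|x []]] //= /andP[/= pp /eqP lp] _; rewrite /path_length /=.
- by move=> _; exists s; rewrite /= -lp !refl /midpoint /=
    connect0 /step_len eqxx.
- rewrite addn0 lp in pp * => le.
  have /andP[c i] := conn _ _ (proj1 (andP pp)).
  exists t; rewrite /= refl i /midpoint /= c connect0 /step_len eqxx addn0 /=
    andbT.
  exact: leq_trans (step_len_le _ _) le.
- rewrite addn0 lp in pp * => le.
  have /and3P[/conn/andP[c1 i1] /conn/andP[c2 i2] _] := pp.
  exists w; rewrite /= i1 i2 /midpoint /= c1 c2 /= andbT.
  by apply: leq_trans le; rewrite leq_add ?step_len_le.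
Qed.

Lemma midpoint_hopset H : H \subset candidate_edges I ->
  (forall p : V * V, p \in demand I -> exists w,
     [&& midpoint w p, (p.1, w) \in free_steps :|: H
       & (w, p.2) \in free_steps :|: H]) ->
  hopset 2 I H.
Proof.
move=> HC cov; split=> // s t /cov[w /and3P[/and3P[/= _ _ le] i1 i2]].
have aug u v : (u, v) \in free_steps :|: H -> u != v -> augmented_edge I H u v.
  by move=> uvH /negbTE uv; move: uvH; rewrite !inE /= uv.
have [swE|sw] := eqVneq s w.
  subst w; rewrite /step_len eqxx add0n in le.
  have [stE|st] := eqVneq s t; first by exists [::]; split;
    rewrite // /st_path /= stE.
  exists [:: t]; split=> //; first by rewrite /st_path /= aug // eqxx.
  by rewrite /path_length /= addn0; move: le; rewrite (negbTE st).
have [wtE|wt] := eqVneq w t.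
  subst w; exists [:: t]; split=> //; first by rewrite /st_path /= aug // eqxx.
  by move: le; rewrite /step_len (negbTE sw) eqxx addn0 /path_length /= addn0.
exists [:: w; t]; split=> //; first by rewrite /st_path /= !aug // eqxx.
by move: le; rewrite /step_len (negbTE sw) (negbTE wt) /path_length /= addn0.
Qed.

End Walks.

(** * Programs *)

Definition notE e := Sub (Const 1) e.
Definition andE e1 e2 := notE (Add (notE e1) (notE e2)).
Definition leE e1 e2 := notE (Sub e1 e2).
Definition ltE e1 e2 := Sub e2 e1.
Definition eqE e1 e2 := notE (Add (Sub e1 e2) (Sub e2 e1)).

Lemma eval_not m e : (eval m (notE e) != 0) = (eval m e == 0).
Proof. by rewrite /=; case: (eval m e) => [|[]]. Qed.

Lemma eval_or m e1 e2 :
  (eval m (Add e1 e2) != 0) = (eval m e1 != 0) || (eval m e2 != 0).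
Proof. by rewrite /= addn_eq0 negb_and. Qed.

Lemma eval_and m e1 e2 :
  (eval m (andE e1 e2) != 0) = (eval m e1 != 0) && (eval m e2 != 0).
Proof.
rewrite /andE eval_not -[_ == 0]negbK eval_or !eval_not negb_or.
by case: (eval m e1); case: (eval m e2).
Qed.

Lemma eval_le m e1 e2 : (eval m (leE e1 e2) != 0) = (eval m e1 <= eval m e2).
Proof. by rewrite eval_not /= subn_eq0. Qed.

Lemma eval_lt m e1 e2 : (eval m (ltE e1 e2) != 0) = (eval m e1 < eval m e2).
Proof. by rewrite /= subn_eq0 -ltnNge. Qed.

Lemma eval_eq m e1 e2 : eval m (eqE e1 e2) = (eval m e1 == eval m e2).
Proof. by rewrite /=; case: eqP; lia. Qed.

Definition evalE := (eval_and, eval_le, eval_lt, eval_eq, eval_not, eval_or).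

Definition lenE x y := Read 0 (Add (Const 1) (cell x y)).
Definition boundE x y :=
  Read 0 (Add (Const 1) (Add (Read 2 (Read 0 (Const 0))) (cell x y))).

Lemma nth_allpairs (T : Type) (f : T -> T -> nat) (s t : seq T) k x i j :
  size t = k -> i < size s -> j < k ->
  nth 0 [seq f y z | y <- s, z <- t] (i * k + j) = f (nth x s i) (nth x t j).
Proof.
move=> <-; elim: s i => //= y s IHs [|i] is_ jt; rewrite nth_cat size_map.
  by rewrite jt (nth_map x).
by rewrite mulSn -addnA ltnNge leq_addr /= addKn IHs.
Qed.

(** Carries functions of vertices over to the loop rules, which speak of natural numbers; the
    default is never reached, as all indices are below n. *)
Definition nat_ext (n : nat) (T : Type) (d : T) (f : 'I_n -> 'I_n -> T)
    (k l : nat) :=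
  if insub k is Some i then if insub l is Some j then f i j else d else d.

Lemma nat_ext_ord n T (d : T) (f : 'I_n -> 'I_n -> T) (i j : 'I_n) :
  nat_ext d f i j = f i j.
Proof. by rewrite /nat_ext !valK. Qed.

(** * Reading the encoded instance *)

Section Instance.

Variables (n : nat) (I : instance 'I_n).

Definition input := initial_memory (encode_instance I) 0.

Lemma input_size_n : input 0 = n. Proof. by []. Qed.

Lemma input_len (i j : 'I_n) :
  input (1 + (i * n + j)) = if edge I i j then len I i j else 0.
Proof.
rewrite /input /initial_memory /= nth_cat size_allpairs size_enum_ord.
have ij : i * n + j < n * n.
  by apply: (@leq_trans (i.+1 * n)); [rewrite mulSn; have := ltn_ord j;
    lia|rewrite leq_mul2r ltn_ord orbT].
rewrite add0n ij (nth_allpairs _ i) ?size_enum_ord //.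
by rewrite !nth_ord_enum.
Qed.

Lemma input_bound (i j : 'I_n) :
  input (1 + (n * n + (i * n + j))) =
    if (i, j) \in demand I then (bound I i j).+1 else 0.
Proof.
rewrite /input /initial_memory /= nth_cat size_allpairs size_enum_ord.
rewrite !add0n ltnNge leq_addr /= addKn.
by rewrite (nth_allpairs _ i) ?size_enum_ord // !nth_ord_enum.
Qed.

(** Allows [exec_compile] to be applied with the bit size of the input as its bound on n; every
    number contributes at least one bit. *)
Lemma size_encode : n <= Defs.input_size (encode_instance I).
Proof.
have : n <= size (encode_instance I).
  by rewrite /= size_cat !size_allpairs !size_enum_ord; nia.
move/leq_trans; apply; rewrite /Defs.input_size -sum1_size.
exact: leq_sum.
Qed.

Definition ready m := m 0 = input /\ forall i, i <= n -> m 2 i = i * n.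

Lemma ready_rows m : ready m -> row_table n m.
Proof. by case=> m0 mr; split; rewrite ?m0. Qed.

Lemma ready_agree l m m1 : 0 \notin l -> 2 \notin l -> agree_off l m m1 ->
  ready m -> ready m1.
Proof. by move=> l0 l2 ma [m0 m2]; split; rewrite ma. Qed.

Lemma ready_sem s m :
  0 \notin writes s -> 2 \notin writes s -> ready m -> ready (sem s m).
Proof. by move=> s0 s2 [m0 m2]; split; rewrite sem_frame. Qed.

Lemma eval_entry m a x y (i j : nat) : ready m -> eval m x = i ->
  eval m y = j ->
  i <= n -> eval m (entry a x y) = m a (i * n + j).
Proof. by move=> [_ mr] /= -> -> iN; rewrite mr. Qed.

Lemma eval_len m x y (i j : 'I_n) : ready m -> eval m x = i -> eval m y = j ->
  eval m (lenE x y) = if edge I i j then len I i j else 0.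
Proof.
by move=> [m0 mr] /= -> ->; rewrite mr 1?ltnW // m0 input_len.
Qed.

Lemma eval_bound m x y (i j : 'I_n) : ready m -> eval m x = i -> eval m y = j ->
  eval m (boundE x y) = if (i, j) \in demand I then (bound I i j).+1 else 0.
Proof.
move=> [m0 mr] /= -> ->; rewrite m0 input_size_n !mr // 1?ltnW //.
exact: input_bound.
Qed.

(** [mset (m 1)] is convertible with [decode_output n m], so the sets used during the computation
    and the output are read the same way. *)
Definition mset (f : nat -> nat) : {set 'I_n * 'I_n} :=
  [set e : 'I_n * 'I_n | f (e.1 * n + e.2) != 0].

Lemma fill_ord m a e x (b : rel 'I_n) (v : 'I_n -> 'I_n -> nat) :
  ready m -> a \notin [:: 0; 2; 10; 11] ->
  (forall (m1 : memory) (i j : 'I_n), m1 10 0 = i -> m1 11 0 = j -> ready m1 ->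
     agree_off [:: a; 10; 11] m m1 ->
     (eval m1 e != 0) = b i j /\ (b i j -> eval m1 x = v i j)) ->
  forall i j : 'I_n,
    sem (fill a e x) m a (i * n + j) =
      if b i j then v i j else m a (i * n + j).
Proof.
move=> rm an ev i j.
have := @fill_spec n m a e x (nat_ext false b) (nat_ext 0 v) (ready_rows rm) an.
move=> /(_ _ i j (ltn_ord i) (ltn_ord j)).
rewrite !nat_ext_ord; apply=> m1 k l kn ln mk ml ma.
rewrite -[k]/(val (Ordinal kn)) -[l]/(val (Ordinal ln)) !nat_ext_ord.
apply: ev => //.
by apply: ready_agree ma rm; apply: contra an; rewrite !inE =>
  /or3P[/eqP<-|//|//].
Qed.

Lemma fill_set m a e (b : rel 'I_n) :
  ready m -> a \notin [:: 0; 2; 10; 11] ->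
  (forall (m1 : memory) (i j : 'I_n), m1 10 0 = i -> m1 11 0 = j -> ready m1 ->
     agree_off [:: a; 10; 11] m m1 -> (eval m1 e != 0) = b i j) ->
  forall k, mset (sem (fill a e (Const k)) m a) =
    if k == 0 then mset (m a) :\: [set p | b p.1 p.2]
    else mset (m a) :|: [set p | b p.1 p.2].
Proof.
move=> rm an ev k; apply/setP => -[i j]; rewrite in_set.
rewrite -[(i, j).1]/i -[(i, j).2]/j.
rewrite (fill_ord (b := b) (v := fun _ _ => k) rm an) //; last first.
  by move=> m1 i' j' mi mj r ma; split=> //; exact: ev.
by case: k => [|k]; rewrite !inE /=; case: (b i j); rewrite ?orbT ?orbF.
Qed.

Lemma count_ord m e (b : rel 'I_n) :
  ready m ->
  (forall (m1 : memory) (i j : 'I_n), m1 12 0 = i -> m1 13 0 = j -> ready m1 ->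
     agree_off [:: 8; 12; 13] m m1 -> (eval m1 e != 0) = b i j) ->
  sem (count_pairs e) m 8 0 = #|[set p : 'I_n * 'I_n | b p.1 p.2]|.
Proof.
move=> rm ev; have [m0 _] := ready_rows rm.
rewrite (@count_pairs_spec n m e (nat_ext false b)) //.
  by apply: eq_card => p; rewrite !inE nat_ext_ord.
move=> m1 k l kn ln mk ml ma.
rewrite -[k]/(val (Ordinal kn)) -[l]/(val (Ordinal ln)) !nat_ext_ord.
by apply: ev => //; apply: ready_agree ma rm.
Qed.

End Instance.

(** * All-pairs distances by repeated relaxation *)

Definition rows_prog :=
  For 10 0 (Assign 2 (Add (var 10) (Const 1))
                     (Add (Read 2 (var 10)) (Read 0 (Const 0)))).

(** A round of Bellman-Ford for all targets at once, prepending an edge to a known walk. [tail] is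
    shifted by one and [len] is not, so [new] has the right shift; an [old] equal to 0 is infinite
    and needs its own test. *)
Definition relax_prog :=
  let old := entry 3 (var 10) (var 11) in
  let tail := entry 3 (var 12) (var 11) in
  let new := Add (lenE (var 10) (var 12)) tail in
  For 10 0 (For 11 0 (For 12 0
    (Cond (andE (lenE (var 10) (var 12))
             (andE tail (Add (notE old) (ltE new old))))
       (Assign 3 (cell (var 10) (var 11)) new)))).

(* Array 3 holds the distance matrix; distances are shifted by one, and 0 stands
   for infinity. *)
Definition dist_prog :=
  Then (fill 3 (Const 1) (eqE (var 10) (var 11))) (For 14 0 relax_prog).

Section Distances.

Variables (n : nat) (I : instance 'I_n) (lmax : {poly nat}).
Hypothesis lens : lengths_within lmax I.

Lemma rows_ready m : m 0 = input I -> m 2 0 = 0 -> ready I (sem rows_prog m).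
Proof.
move=> m0 m2; split; first by rewrite sem_frame.
pose P i m1 := m1 0 = input I /\ forall j, j <= i -> m1 2 j = j * n.
have := @for_ind P 10 0 (Assign 2 (Add (var 10) (Const 1))
                     (Add (Read 2 (var 10)) (Read 0 (Const 0)))) m.
have -> : m 0 0 + 0 = n by rewrite m0 input_size_n addn0.
case.
- by move=> i x m1 [a b]; split; rewrite update_other.
- by split=> // -[|] // _; rewrite m2.
- move=> i m1 iN mi [m10 m12]; split; first by rewrite sem_frame.
  move=> j; rewrite leq_eqVlt => /orP[/eqP->|].
    by rewrite /= mi /update !eqxx addn1 eqxx /=
      m12 // m10 input_size_n mulSn addnC.
  by rewrite ltnS => ji; rewrite /= mi /update /= addn1 ltn_eqF //= m12.
- by [].
Qed.

Definition dist_le (m : memory) i j d := 0 < m 3 (i * n + j) <= d.+1.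

Definition dist_sound m := forall i j : 'I_n, m 3 (i * n + j) != 0 ->
  exists2 p, st_path (edge I) i j p
           & (path_length (len I) i p).+1 = m 3 (i * n + j).

Definition relax_inv m0 m :=
  [/\ agree_off [:: 3; 10; 11; 12] m0 m, dist_sound m &
      forall (i j : 'I_n) d, dist_le m0 i j d -> dist_le m i j d].

Lemma relax_step (m : memory) (u v w : 'I_n) :
  let old := entry 3 (var 10) (var 11) in
  let tail := entry 3 (var 12) (var 11) in
  let new := Add (lenE (var 10) (var 12)) tail in
  let m' := sem (Cond (andE (lenE (var 10) (var 12))
             (andE tail (Add (notE old) (ltE new old))))
       (Assign 3 (cell (var 10) (var 11)) new)) m in
  m 10 0 = u -> m 11 0 = v -> m 12 0 = w -> ready I m -> dist_sound m ->
  [/\ dist_sound m',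
      forall (i j : 'I_n) d, dist_le m i j d -> dist_le m' i j d
    & forall d, edge I u w -> dist_le m w v d ->
        dist_le m' u v (len I u w + d)].
Proof.
move=> old tail new m' mu mv mw rm sm.
have eold : eval m old = m 3 (u * n + v).
  by apply: (eval_entry (x := var 10) (y := var 11) 3 rm mu mv); apply: ltnW.
have etail : eval m tail = m 3 (w * n + v).
  by apply: (eval_entry (x := var 12) (y := var 11) 3 rm mw mv); apply: ltnW.
have elen : eval m (lenE (var 10) (var 12)) =
  if edge I u w then len I u w else 0.
  by apply: eval_len.
have enew : eval m new = eval m (lenE (var 10) (var 12)) + eval m tail by [].
have ecell : eval m (cell (var 10) (var 11)) = u * n + v.
  by case: rm => _ mr; rewrite /= mu mv mr // ltnW.
pose D i j := m 3 (i * n + j).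
pose better := [&& edge I u w, D w v != 0 &
  (D u v == 0) || (len I u w + D w v < D u v)].
have m'E (i j : 'I_n) : m' 3 (i * n + j) =
    if better && ((i, j) == (u, v)) then len I u w + D w v else D i j.
  have -> : m' =
      if better then update m 3 (u * n + v) (len I u w + D w v) else m.
    rewrite /m' sem_cond sem_assign !evalE ecell enew elen etail eold /better
      /D.
    have [e|] := boolP (edge I u w) => //=.
    by have /andP[l0 _] := lens e; rewrite -!lt0n l0.
  case: better => //=; rewrite /update /= cell_inj // xpair_eqE -!val_eqE /=.
split.
- move=> i j; rewrite m'E; case: ifP => [/andP[/and3P[e Dn _]
    /eqP[-> ->]] _|_ Dij].
    have [p /andP[pp lp] pl] := sm w v Dn.
    exists (w :: p); first by rewrite /st_path /= e pp.
    by rewrite /path_length /= -addnS; congr addn.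
  exact: sm.
- move=> i j d; rewrite /dist_le m'E -/(D i j).
  case: ifP => // /andP[/and3P[e Dn] /orP Dl /eqP[-> ->]] /andP[D0 Dd].
  by case: Dl => Dl; lia.
- move=> d e; rewrite /dist_le m'E -/(D w v) eqxx andbT => /andP[D0 Dd].
  case: ifP => [_|/negbT]; first lia.
  by rewrite /better e -lt0n D0 /= negb_or -lt0n -leqNgt => /andP[-> ?]; lia.
Qed.

(** The matrix is updated in place, so a relaxation may read entries already improved in the same
    round. This is harmless: entries only decrease once finite and remain lengths of actual
    walks. *)
Lemma relax_spec m : ready I m -> dist_sound m ->
  let m' := sem relax_prog m in
  [/\ dist_sound m', forall (i j : 'I_n) d, dist_le m i j d -> dist_le m' i j d
    & forall (u v w : 'I_n) d, edge I u w -> dist_le m w v d ->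
        dist_le m' u v (len I u w + d)].
Proof.
move=> rm sm.
rewrite /relax_prog; set step := Cond _ _.
pose Q1 (u v w : nat) m1 := forall (u' v' w' : 'I_n) d,
  u = u' -> v = v' -> w = w' -> edge I u' w' -> dist_le m w v d ->
  dist_le m1 u v (len I u' w' + d).
pose Q u v m1 := forall w, w < n -> Q1 u v w m1.
have rL m1 : agree_off [:: 3; 10; 11; 12] m m1 -> ready I m1.
  by move=> ma; apply: ready_agree ma rm.
have Ik x k m1 : k \in [:: 10; 11; 12] -> relax_inv m m1 ->
  relax_inv m (update m1 k 0 x).
  move=> k1 [ma ms mm].
  have k3 : 3 != k by apply: contraTneq k1 => <-.
  split; first by apply: agree_off_update => //; rewrite inE k1 orbT.
  - by move=> i j; rewrite update_other //; exact: ms.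
  - by move=> i j d /mm; rewrite /dist_le update_other.
have Q1k u v w x k m1 : k \in [:: 10; 11; 12] -> Q1 u v w m1 ->
  Q1 u v w (update m1 k 0 x).
  move=> k1 q u' v' w' d eu ev ew e dd.
  have k3 : 3 != k by apply: contraTneq k1 => <-.
  by rewrite /dist_le update_other //; apply: (q u' v' w').
have sub k : k \in [:: 10; 11] -> k \in [:: 10; 11; 12].
  by rewrite !inE => /orP[]->; rewrite ?orbT.
have [] := @for2_all (relax_inv m) Q 10 11 (For 12 0 step) m n.
- by case: rm => ->.
- by [].
- by [].
- by move=> x k m1 /sub; exact: Ik.
- by move=> i j x k m1 /sub k1 q w wn; apply: Q1k => //; exact: q.
- by move=> m1 [/rL[-> _] _ _].
- by split.
- move=> u v m1 un vn mu mv mI.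
  pose Inv m2 := [/\ relax_inv m m2, m2 10 0 = u, m2 11 0 = v &
    forall (i j : 'I_n) d, dist_le m1 i j d -> dist_le m2 i j d].
  have [] := @for_all Inv (Q1 u v) 12 0 step m1.
  + move=> x m2 [I2 u2 v2 mm]; split; rewrite ?update_other //.
    exact: Ik.
  + by move=> w x m2; apply: Q1k.
  + by split.
  + have [/rL[-> _] _ _] := mI; rewrite input_size_n addn0.
    move=> w m2 wn mw [[ma2 ms2 mm2] mu2 mv2 mm].
    have [] := @relax_step m2 (Ordinal un) (Ordinal vn) (Ordinal wn) mu2 mv2 mw
      (rL _ ma2) ms2.
    rewrite -/step => s3 mm3 new3.
    split.
    * split; rewrite ?sem_frame //; last by move=> i j d /mm/mm3.
      split=> //; last by move=> i j d /mm2/mm3.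
      exact: agree_off_sem.
    * move=> u' v' w' d eu ev ew e dd.
      have eu' : Ordinal un = u' by exact: val_inj.
      have ew' : Ordinal wn = w' by exact: val_inj.
      rewrite eu' ew' /= -eu in new3; apply: new3 => //.
      by have := mm2 (Ordinal wn) (Ordinal vn) d dd; rewrite ew'.
    * move=> w' w'n q u' v' w2 d eu ev ew e dd.
      by apply: (mm3 (Ordinal un) (Ordinal vn)); apply: (q u' v' w2).
  + have [/rL[-> _] _ _] := mI; rewrite input_size_n addn0 => -[I2 _ _ mm] Q2.
    split=> // i j iN jn q w wn u' v' w' d eu ev ew e dd.
    by apply: (mm (Ordinal iN) (Ordinal jn)); apply: (q w wn u' v' w').
- move=> [_ ms mm] Q2; split=> // u v w d e dd.
  exact: (Q2 u v _ _ w _ u v w d).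
Qed.

Lemma dist_spec m : ready I m -> forall i j : 'I_n,
  sem dist_prog m 3 (i * n + j) =
    if connect (edge I) i j then (dG I i j).+1 else 0.
Proof.
move=> rm; rewrite /dist_prog sem_then; set m1 := sem (fill _ _ _) m.
have m1E (i j : 'I_n) : m1 3 (i * n + j) = (i == j).
  rewrite /m1 (fill_ord (b := fun _ _ => true) (v :=
    fun i j => i == j :> nat) rm) //.
  by move=> m2 i' j' mi mj r ma; rewrite eval_eq /= mi mj; split.
have rm1 : ready I m1 by exact: ready_sem.
(* After [r] rounds an entry is at most the length of any walk with at most [r] edges. By loop
   erasure n rounds reach the distance. *)
pose P r m2 := [/\ agree_off [:: 3; 10; 11; 12; 14] m m2, dist_sound m2 &
  forall (i j : 'I_n) p, st_path (edge I) i j p -> size p <= r ->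
    dist_le m2 i j (path_length (len I) i p)].
have := @for_ind P 14 0 relax_prog m1.
have -> : m1 0 0 + 0 = n by case: rm1 => -> _; rewrite addn0.
case.
- move=> r x m2 [ma ms mp]; split; first exact: agree_off_update.
    by move=> i j; rewrite update_other //; exact: ms.
  by move=> i j p pp pr; rewrite /dist_le update_other //; exact: mp.
- split.
  + exact: agree_off_sem.
  + move=> i j; rewrite m1E; have [-> _|] := eqVneq i j => //.
    by exists [::]; rewrite /st_path /= ?eqxx.
  + by move=> i j [|//]; rewrite /st_path /= => /eqP-> _;
      rewrite /dist_le m1E eqxx.
- move=> r m2 rn mr [ma ms mp].
  have rm2 : ready I m2 by apply: ready_agree ma rm.
  have [ms3 mm3 new3] := relax_spec rm2 ms.
  split=> //.
    exact: agree_off_sem.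
  move=> i j [|w p] /andP[pp lp] ps; first by apply/mm3/mp => //;
    rewrite /st_path pp.
  case/andP: pp => iw pp.
  by apply: (new3 i j w) => //; apply: mp => //; apply/andP.
- move=> _ ms mp i j.
  case: ifP => [/connect_st_path[p pp]|ncon].
    have [q qq [qs _]] := short_walk (len I) pp.
    rewrite card_ord in qs.
    have /andP[d0 _] := mp i j q qq (ltnW qs).
    rewrite lt0n in d0; have [p' pp' pE] := ms i j d0.
    rewrite -pE; congr _.+1; apply/esym/dG_eq; split; first by exists p'.
    move=> p2 /(short_walk (len I))[q2 qq2 [qs2 ql2]].
    rewrite card_ord in qs2; apply: leq_trans ql2.
    by have /andP[_] := mp i j q2 qq2 (ltnW qs2); rewrite -pE.
  apply/eqP; apply: contraFT ncon => /ms[p pp _].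
  by apply/connect_st_path; exists p.
Qed.

End Distances.

(* Matrices are stored in row-major order: array 1 holds H, array 4 the lengths
   of the steps (shifted like the distances), array 5 the free steps, array 6
   the uncovered demands, array 7 the steps that survive the peeling. Cell [i]
   of array 2 is [i * n], as multiplication is not available. Arrays 8 and 9
   hold a counter and the threshold d; from 10 on, loop counters. *)
Definition tables_prog :=
  let u := var 10 in
  let v := var 11 in
  Then rows_prog (Then dist_prog (
  Then (fill 4 (Const 1) (entry 3 u v)) (
  Then (fill 4 (lenE u v) (Add (lenE u v) (Const 1))) (
  Then (fill 4 (eqE u v) (Const 1)) (
  Then (fill 5 (Const 1) (Add (eqE u v) (lenE u v)))
       (fill 6 (Const 1) (boundE u v))))))).

(** The two step lengths carry a shift of one each and the bound carries one, whence the added 1.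
    For a pair that is not a demand the right-hand side is 1 and the left-hand side at least 2, so
    membership in the demand set is tested implicitly. *)
Definition liveE s w t :=
  andE (entry 4 s w) (andE (entry 4 w t)
    (andE (leE (Add (entry 4 s w) (entry 4 w t)) (Add (boundE s t) (Const 1)))
       (andE (entry 7 s w) (entry 7 w t)))).

Definition usesE w s t u v :=
  Add (andE (eqE u s) (eqE v w)) (andE (eqE u w) (eqE v t)).

Definition test_prog :=
  let: (s, t, w, u, v) := (var 12, var 13, var 16, var 20, var 21) in
  Then (count_pairs (andE (entry 6 s t) (andE (liveE s w t) (usesE w s t u v))))
    (Cond (andE (ltE (var 8) (var 9)) (notE (entry 5 u v)))
       (Assign 7 (cell u v) (Const 0))).

(* A sweep that is not the last one removes a step, so [n * n] suffice. *)
Definition peel_prog := For 17 0 (For 18 0 (For 20 0 (For 21 0 test_prog))).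

(** Peeling starts from all pairs, so that what survives contains every stable set. Pairs irrelevant
    to the midpoint have load 0 and, if not free, are peeled as long as the threshold is
    positive. *)
Definition star_prog :=
  let u := var 10 in
  let v := var 11 in
  Then (fill 7 (Const 1) (Const 1)) (Then peel_prog (
  Then (fill 1 (andE (entry 7 u v) (notE (entry 5 u v))) (Const 1))
       (fill 6 (liveE u (var 16) v) (Const 0)))).

(** * Correctness of the peeling program *)

Section Star.

Variables (n : nat) (I : instance 'I_n) (lmax : {poly nat}).
Hypothesis lens : lengths_within lmax I.

Definition static m :=
  [/\ ready I m,
      forall i j : 'I_n, m 4 (i * n + j) =
        if connect (edge I) i j then (step_len I i j).+1 else 0
    & mset n (m 5) = free_steps I].

Definition valid w p := (p \in demand I) && midpoint I w p.

Lemma static_agree l m m1 :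
  all (fun a => a \notin l) [:: 0; 2; 4; 5] -> agree_off l m m1 ->
  static m -> static m1.
Proof.
move=> /= /and5P[l0 l2 l4 l5 _] ma [rm m4 m5].
by split; rewrite ?ma //; apply: ready_agree ma rm.
Qed.

Lemma static_sem s m :
  all (fun a => a \notin writes s) [:: 0; 2; 4; 5] -> static m ->
    static (sem s m).
Proof.
move=> sl; apply: (static_agree sl).
by apply: agree_off_sem => //; apply/allP.
Qed.

(** Array 4 is filled three times, and the order encodes the priorities in [step_len]: the length of
    an edge overrides d_G, and the diagonal overrides both. *)
Lemma tables_spec m : m 0 = input I -> m 2 0 = 0 ->
  static (sem tables_prog m) /\ mset n (sem tables_prog m 6) = demand I.
Proof.
move=> m0 m2; rewrite /tables_prog !sem_then.
set f41 := fill 4 (Const 1) _; set f42 := fill 4 (lenE _ _) _.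
set f43 := fill 4 (eqE _ _) _; set f5 := fill 5 _ _; set f6 := fill 6 _ _.
set m1 := sem rows_prog m; set m3 := sem dist_prog m1.
set m41 := sem f41 m3; set m42 := sem f42 m41; set m43 := sem f43 m42.
set m5 := sem f5 m43; set m6 := sem f6 m5.
have r1 : ready I m1 by exact: rows_ready.
have r3 : ready I m3 by exact: ready_sem.
have r41 : ready I m41 by exact: ready_sem.
have r42 : ready I m42 by exact: ready_sem.
have r43 : ready I m43 by exact: ready_sem.
have r5 : ready I m5 by exact: ready_sem.
have r6 : ready I m6 by exact: ready_sem.
have ulen (m' : memory) (i j : 'I_n) : m' 10 0 = i -> m' 11 0 = j ->
  ready I m' ->
    eval m' (lenE (var 10) (var 11)) = if edge I i j then len I i j else 0.
  by move=> mi mj r; apply: eval_len.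
have llen i j : ((if edge I i j then len I i j else 0) != 0) = edge I i j.
  by case: ifP => // /lens/andP[]; rewrite -lt0n.
have E41 (i j : 'I_n) : m41 4 (i * n + j) =
    if connect (edge I) i j then (dG I i j).+1 else 0.
  rewrite /m41 (fill_ord (I := I) (b := fun _ _ => true)
    (v := fun i j => if connect (edge I) i j then (dG I i j).+1 else 0)) //.
  move=> m' i' j' mi mj r ma; split=> // _.
  rewrite (eval_entry (x := var 10) (y := var 11) 3 r mi mj) 1?ltnW // ma //.
  by rewrite /m3 (dist_spec lens).
have E42 (i j : 'I_n) : m42 4 (i * n + j) =
    if edge I i j then (len I i j).+1 else m41 4 (i * n + j).
  rewrite /m42 (fill_ord (I := I) (b := fun i j => edge I i j)
    (v := fun i j => (len I i j).+1)) //.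
  move=> m' i' j' mi mj r ma; split=> [|e].
    by rewrite (ulen _ i' j') // llen.
  by rewrite -[LHS]/(eval m' (lenE (var 10) (var 11)) + 1) (ulen _ i' j') // e
    addn1.
have E43 (i j : 'I_n) : m43 4 (i * n + j) =
    if i == j then 1 else m42 4 (i * n + j).
  rewrite /m43 (fill_ord (I := I) (b := fun i j => i == j)
    (v := fun _ _ => 1)) //.
  by move=> m' i' j' mi mj r ma; rewrite eval_eq /= mi mj val_eqE eqb0 negbK.
split; last first.
  apply/setP => -[i j]; rewrite in_set -[(i, j).1]/i -[(i, j).2]/j.
  rewrite /m6 (fill_ord (I := I) (b := fun _ _ => true)
    (v := fun i j => if (i, j) \in demand I then (bound I i j).+1 else 0)) //.
    by case: ifP.
  by move=> m' i' j' mi mj r ma; split=> // _; apply: eval_bound.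
split=> //.
- move=> i j; rewrite /m6 sem_frame // /m5 sem_frame // E43 E42 E41 /step_len.
  case: eqP => [->|_]; first by rewrite connect0.
  rewrite /augmented_len; case: ifP => // e.
  by rewrite connect1.
- apply/setP => -[i j]; rewrite in_set -[(i, j).1]/i
    -[(i, j).2]/j /m6 sem_frame //.
  rewrite /m5 (fill_ord (I := I) (b := fun _ _ => true)
    (v := fun i j => (i == j) + if edge I i j then len I i j else 0)) //.
    by rewrite addn_eq0 negb_and llen eqb0 negbK inE.
  move=> m' i' j' mi mj r ma; split=> // _.
  rewrite -(ulen m' i' j') // -[LHS]/(eval m' (eqE (var 10) (var 11)) +
    eval m' (lenE (var 10) (var 11))).
  by rewrite eval_eq /= mi mj val_eqE.
Qed.

Lemma eval_entry_set (m : memory) a x y (i j : 'I_n) : ready I m ->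
  eval m x = i -> eval m y = j ->
  (eval m (entry a x y) != 0) = ((i, j) \in mset n (m a)).
Proof.
by move=> r ex ey; rewrite (eval_entry a r ex ey) 1?ltnW // in_set.
Qed.

Lemma eval_live (m : memory) s w t (i k j : 'I_n) : static m ->
  eval m s = i -> eval m w = k -> eval m t = j ->
  (eval m (liveE s w t) != 0) =
    [&& valid k (i, j), (i, k) \in mset n (m 7) & (k, j) \in mset n (m 7)].
Proof.
move=> [r m4 _] es ew et.
have e4 x y (a b : 'I_n) : eval m x = a -> eval m y = b ->
  eval m (entry 4 x y) =
     if connect (edge I) a b then (step_len I a b).+1 else 0.
  by move=> ea eb; rewrite (eval_entry 4 r ea eb) 1?ltnW.
have eD e1 e2 : eval m (Add e1 e2) = eval m e1 + eval m e2 by [].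
rewrite !evalE !eD (eval_bound r es et).
rewrite (eval_entry_set 7 r es ew) (eval_entry_set 7 r ew et)
  (e4 _ _ _ _ es ew) (e4 _ _ _ _ ew et) /=.
rewrite /valid /midpoint /=; case: connect => //=; last by rewrite andbF.
case: connect => //=; last by rewrite andbF.
case: ((i, j) \in demand I) => /=; last by lia.
congr (_ && _); lia.
Qed.

Lemma test_spec (m : memory) (w u v : 'I_n) : static m ->
  m 16 0 = w -> m 20 0 = u -> m 21 0 = v ->
  let K := mset n (m 7) in
  mset n (sem test_prog m 7) =
    if (load valid w (mset n (m 6)) K (u, v) < m 9 0) &&
       ((u, v) \notin free_steps I)
    then K :\ (u, v) else K.
Proof.
move=> sm mw mu mv K; have [r _ mf] := sm.
rewrite /test_prog sem_then; set e := andE (entry 6 _ _) _.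
set m1 := sem (count_pairs e) m.
have r1 : ready I m1 by exact: ready_sem.
have m1E a : a \notin [:: 8; 12; 13] -> m1 a = m a.
  by move=> an; rewrite /m1 sem_frame //; apply: contra an; rewrite /= !inE;
    do ![case/orP] => ->; rewrite ?orbT.
have c8 : m1 8 0 = load valid w (mset n (m 6)) K (u, v).
  rewrite /m1 (count_ord (I := I) (b := fun s t =>
    ((s, t) \in live valid w (mset n (m 6)) K)
     && uses w (s, t) (u, v))) //.
    by apply: eq_card => -[s t]; rewrite !inE.
  move=> m2 s t ms mt r2 ma.
  have sm2 : static m2 by apply: static_agree ma sm.
  have w2 : m2 16 0 = w by rewrite ma.
  have u2 : m2 20 0 = u by rewrite ma.
  have v2 : m2 21 0 = v by rewrite ma.
  rewrite /e 2!eval_and (eval_entry_set (x := var 12) (y := var 13) 6 r2 ms mt).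
  rewrite (eval_live (s := var 12) (w := var 16) (t := var 13) sm2 ms w2 mt).
  rewrite [X in _ && (_ && X)](_ : _ = uses w (s, t) (u, v)).
    by rewrite !ma // andbA [(s, t) \in live _ _ _ _]in_set.
  rewrite /usesE eval_or !eval_and !eval_eq /= w2 u2 v2 ms mt !eqb0 !negbK.
  by rewrite /uses !xpair_eqE.
rewrite sem_cond eval_and eval_lt eval_not sem_assign.
have u1 : eval m1 (var 20) = u by rewrite /= m1E.
have v1 : eval m1 (var 21) = v by rewrite /= m1E.
rewrite -[_ == 0]negbK (eval_entry_set 5 r1 u1 v1) /= c8 !m1E // mf.
case: ifP => _; last by rewrite m1E.
apply/setP => -[i j]; rewrite !inE /= /update /= mu mv !m1E //.
have [_ mr] := r; rewrite mr 1?ltnW // cell_inj // xpair_eqE -!val_eqE /=.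
by case: ifP.
Qed.

End Star.

Section Phase.

Variables (n : nat) (I : instance 'I_n).

Definition maximal_stable d w U (K : {set 'I_n * 'I_n}) :=
  stable (valid I) (free_steps I) d w U K /\
  forall S, stable (valid I) (free_steps I) d w U S -> S \subset K.

(** Loads grow with the set, so a step of a stable subset never falls below the threshold and is
    never removed. *)
Lemma sweep_spec m (w : 'I_n) : static I m -> m 16 0 = w ->
  let m' := sem (For 20 0 (For 21 0 test_prog)) m in
  let U := mset n (m 6) in
  let K := mset n (m 7) in
  let K' := mset n (m' 7) in
  let st := stable (valid I) (free_steps I) (m 9 0) w U in
  [/\ K' \subset K, forall S, st S -> S \subset K -> S \subset K'
    & K' = K -> st K].
Proof.
move=> sm mw m' U K K' st.
pose L := [:: 7; 8; 12; 13; 20; 21].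
pose Inv m1 := [/\ agree_off L m m1, mset n (m1 7) \subset K
  & forall S, st S -> S \subset K -> S \subset mset n (m1 7)].
(* The set only shrinks, so if it still equals [K] at the end, every test was made against [K]
   itself and removed nothing. *)
pose Q (u v : nat) (m1 : memory) := mset n (m1 7) = K ->
  forall e : 'I_n * 'I_n, e.1 = u :> nat -> e.2 = v :> nat ->
  e \in K -> e \notin free_steps I -> m 9 0 <= load (valid I) w U K e.
have k7 k : k \in [:: 20; 21] -> 7 != k by apply: contraTneq => <-.
have [] := @for2_all Inv Q 20 21 test_prog m n.
- by have [[-> _] _ _] := sm.
- by [].
- by [].
- move=> x k m1 k1 [ma mK mS]; rewrite /Inv update_other ?k7 //; split=> //.
  by apply: agree_off_update => //; move: k1; rewrite !inE => /orP[]->;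
    rewrite ?orbT.
- by move=> i j x k m1 k1; rewrite /Q update_other ?k7.
- by move=> m1 [ma _ _]; rewrite ma //; have [[-> _] _ _] := sm.
- by [].
- move=> i j m1 iN jn mi mj [ma mK mS].
  have sm1 : static I m1 by apply: static_agree ma sm.
  have := @test_spec n I m1 w (Ordinal iN) (Ordinal jn) sm1.
  rewrite !(ma 16) // !(ma 9) // !(ma 6) // => /(_ mw mi mj) tE.
  set K1 := mset n (m1 7) in mK mS tE *.
  have sub : mset n (sem test_prog m1 7) \subset K1.
    by rewrite tE; case: ifP => // _; exact: subD1set.
  have same : mset n (sem test_prog m1 7) = K -> K1 = K.
    by move=> E; apply/eqP; rewrite eqEsubset mK -E.
  split.
  + split; first exact: agree_off_sem.
      exact: subset_trans sub mK.
    move=> S sS SK; rewrite tE; case: ifP => [/andP[ld ef]|_]; last exact: mS.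
    rewrite subsetD1 mS //=; apply/negP => eS.
    by have := stable_load sS (mS S sS SK) eS ef; rewrite leqNgt ld.
  + move=> E [u v] /= eu ev; have ee : (u, v) = (Ordinal iN, Ordinal jn).
      by congr pair; exact: val_inj.
    rewrite ee => eK ef; rewrite leqNgt; apply/negP => ld.
    move: (E); rewrite tE (same E) ld ef /= =>
      /setP/(_ (Ordinal iN, Ordinal jn)).
    by rewrite in_setD1 eqxx eK.
  + by move=> i' j' i'n j'n q /same E e ei ej; apply: q.
- move=> [_ mK mS] q; split=> // E e eK ef.
  by apply: (q e.1 e.2).
Qed.

Lemma peel_spec m (w : 'I_n) : static I m -> m 16 0 = w ->
  mset n (m 7) = [set: 'I_n * 'I_n] ->
  maximal_stable (m 9 0) w (mset n (m 6)) (mset n (sem peel_prog m 7)).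
Proof.
move=> sm mw mT; rewrite /peel_prog; set sweep := For 20 0 _.
pose L := [:: 7; 8; 12; 13; 17; 18; 20; 21].
set U := mset n (m 6); set st := stable (valid I) (free_steps I) (m 9 0) w U.
(* Unless the set is already stable, each of the [r] sweeps has removed a pair. After n^2 sweeps the
   second alternative leaves the empty set, which is stable as well. *)
pose P r m1 := [/\ agree_off L m m1,
  forall S, st S -> S \subset mset n (m1 7)
  & st (mset n (m1 7)) \/ #|mset n (m1 7)| + r <= n * n].
have Pk r k x m1 : k \in [:: 17; 18] -> P r m1 -> P r (update m1 k 0 x).
  move=> k1 [ma mS mst].
  have k7 : 7 != k by apply: contraTneq k1 => <-.
  rewrite /P update_other //; split=> //; apply: agree_off_update => //.
  by move: k1; rewrite !inE => /orP[]->; rewrite ?orbT.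
have n0 m1 : agree_off L m m1 -> m1 0 0 + 0 = n.
  by move=> ma; rewrite ma // addn0; have [[-> _] _ _] := sm.
suff [_ mS [mst|mc]] : P (n * n) (sem (For 17 0 (For 18 0 sweep)) m).
- by [].
- split=> // e; rewrite (_ : mset _ _ = set0) ?in_set0 //.
  by apply/eqP; rewrite -cards_eq0; lia.
have := @for_ind (fun r => P (r * n)) 17 0 (For 18 0 sweep) m.
rewrite n0 //; apply.
- by move=> r x m1; exact: Pk.
- split=> //; first by move=> S _; rewrite mT subsetT.
  by right; rewrite mT cardsT card_prod card_ord addn0.
- move=> r m1 rn mr Pr; rewrite mulSn addnC.
  have := @for_ind (fun q => P (r * n + q)) 18 0 sweep m1.
  rewrite n0; last by case: Pr.
  apply; first by move=> q x m2; exact: Pk.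
    by rewrite addn0.
  move=> q m2 qn mq [ma mS mst]; rewrite addnS.
  have sm2 : static I m2 by apply: static_agree ma sm.
  have := @sweep_spec m2 w sm2; rewrite !(ma 16) // !(ma 9) // !(ma 6) //.
  move=> /(_ mw) [sub keep stab].
  split; first exact: agree_off_sem.
    by move=> S sS; apply: keep => //; exact: mS.
  have [E|neq] := eqVneq (mset n (sem sweep m2 7)) (mset n (m2 7)).
    by left; rewrite E; exact: stab.
  case: mst => [st2|c2].
    by case/eqP: neq; apply/eqP; rewrite eqEsubset sub keep.
  right; apply: leq_trans c2; rewrite addnS -addSn leq_add2r.
  by apply: proper_card; rewrite properEneq neq.
Qed.

Lemma star_spec m (w : 'I_n) : static I m -> m 16 0 = w ->
  exists2 K, maximal_stable (m 9 0) w (mset n (m 6)) K &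
    mset n (sem star_prog m 1) = mset n (m 1) :|: (K :\: free_steps I) /\
    mset n (sem star_prog m 6) =
      mset n (m 6) :\: live (valid I) w (mset n (m 6)) K.
Proof.
move=> sm mw; rewrite /star_prog !sem_then.
set f7 := fill 7 _ _; set f1 := fill 1 _ _; set f6 := fill 6 _ _.
set m1 := sem f7 m; set m2 := sem peel_prog m1; set m3 := sem f1 m2.
have sm1 : static I m1 by exact: static_sem.
have sm2 : static I m2 by exact: static_sem.
have sm3 : static I m3 by exact: static_sem.
have [r _ _] := sm; have [r2 _ f2] := sm2; have [r3 _ _] := sm3.
exists (mset n (m2 7)).
  have -> : m 9 0 = m1 9 0 by rewrite /m1 sem_frame.
  have -> : m 6 = m1 6 by rewrite /m1 sem_frame.
  apply: peel_spec => //; first by rewrite /m1 sem_frame.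
  rewrite /m1 /f7 (fill_set (I := I) (b := fun _ _ => true)) //=.
  by apply/setP => e; rewrite !inE orbT.
split.
  rewrite sem_frame // /m3 /f1.
  rewrite (fill_set (I := I) (b := fun u v =>
    (u, v) \in mset n (m2 7) :\: free_steps I)) //.
    rewrite /= /m2 sem_frame // /m1 sem_frame //; congr (_ :|: _).
    by apply/setP => -[u v]; rewrite inE.
  move=> m' u v mu mv r' ma.
  rewrite eval_and eval_not -[eval m' (entry 5 _ _) == 0]negbK
    !(eval_entry_set (i := u) (j := v) _ r') //.
  by rewrite !ma // f2 in_setD andbC.
rewrite /f6 (fill_set (I := I) (b := fun u v => [&& valid I w (u, v),
   (u, w) \in mset n (m2 7) & (w, v) \in mset n (m2 7)])) //.
  rewrite /= /m3 sem_frame // /m2 sem_frame // /m1 sem_frame //.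
  apply/setP => -[u v]; rewrite !in_setD !inE /=.
  by case: (m 6 _ != 0); rewrite ?andbF ?andbT.
move=> m' u v mu mv r' ma.
have sm' : static I m' by apply: static_agree ma sm3.
rewrite (@eval_live n I m' _ _ _ u w v sm') //.
  by rewrite !ma // /m3 sem_frame.
by rewrite /= ma // /m3 sem_frame // /m2 sem_frame // /m1 sem_frame.
Qed.

End Phase.

(** * The algorithm *)

Definition phase_prog := For 16 0 star_prog.

(* The threshold starts at [(n + 1) ^ 2], so high that the first phase only
   covers demands served by free steps, at no cost. *)
Definition count_prog :=
  For 14 1 (For 15 1 (Assign 9 (Const 0) (Add (var 9) (Const 1)))).

Definition main_prog :=
  Then tables_prog (Then count_prog (For 14 1 (For 15 1
    (Then phase_prog (Assign 9 (Const 0) (Sub (var 9) (Const 1))))))).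

Section Main.

Variables (n : nat) (I : instance 'I_n) (lmax : {poly nat}).
Hypothesis lens : lengths_within lmax I.

Definition partial m :=
  [/\ static I m, mset n (m 1) \subset candidate_edges I,
      mset n (m 6) \subset demand I
    & forall p, p \in demand I -> p \notin mset n (m 6) -> exists w,
        [&& midpoint I w p, (p.1, w) \in free_steps I :|: mset n (m 1)
          & (w, p.2) \in free_steps I :|: mset n (m 1)]].

(** The quantity [d * #|H| + 2 * #|U|] does not increase, because the added steps cost at most what
    [stable_cost] grants for the demands removed. A load never exceeds n^2, so beyond that threshold
    no step is added. *)
Lemma star_partial (m : memory) (w : 'I_n) :
  partial m -> 0 < m 9 0 -> m 16 0 = w ->
  let m' := sem star_prog m in
  [/\ partial m', mset n (m' 6) \subset mset n (m 6),
      exhausted (valid I) (free_steps I) (m 9 0) w (mset n (m' 6)),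
      m 9 0 * #|mset n (m' 1)| + 2 * #|mset n (m' 6)| <=
      m 9 0 * #|mset n (m 1)| + 2 * #|mset n (m 6)|
    & n * n < m 9 0 -> mset n (m' 1) = mset n (m 1)].
Proof.
move=> [sm HC UD cov] d0 mw m'.
have [K [stK maxK] [H' U']] := star_spec sm mw.
rewrite -/m' in H' U'.
set U := mset n (m 6) in UD cov stK maxK U' *.
set H := mset n (m 1) in HC cov H' *.
set d := m 9 0 in d0 stK maxK *.
(* As [d] is positive, a surviving non-free step is used by some live demand, whose validity puts
   the step in the transitive closure. *)
have loaded e : e \in K :\: free_steps I ->
  exists2 p, p \in live (valid I) w U K &
    uses w p e /\ d <= #|U|.
  rewrite in_setD => /andP[ef eK]; have ld := stK e eK ef.
  have /card_gt0P[p] := leq_trans d0 ld.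
  rewrite in_set => /andP[pl pu]; exists p => //; split=> //.
  apply: leq_trans ld _; apply: subset_leq_card; apply/subsetP => q.
  by rewrite !in_set => /andP[/andP[]].
split.
- split.
  + exact: static_sem.
  + rewrite H' subUset HC /=; apply/subsetP => e eK.
    have [p] := loaded e eK; rewrite !inE =>
      /andP[_ /and3P[/andP[_ /and3P[c1 c2 _]] _ _]] [pu _].
    move: eK; rewrite !inE negb_or => /andP[/andP[_ ->] _] /=.
    by case/orP: pu => /eqP->.
  + by rewrite U'; apply: subset_trans (subsetDl _ _) UD.
  + move=> p pD; rewrite U' H' => pnU.
    have [pU|pU] := boolP (p \in U); last first.
      have [v /and3P[mv h1 h2]] := cov p pD pU.
      by exists v; rewrite mv !setUA !(in_setU _ (_ :|: H)) h1 h2.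
    have pl : p \in live (valid I) w U K.
      by move: pnU; rewrite in_setD pU andbT negbK.
    exists w; move: pl; rewrite in_set => /andP[_ /and3P[/andP[_ ->] k1 k2]].
    by rewrite !in_setU !in_setD k1 k2 !andbT; do 2!case: (_ \in free_steps I);
      rewrite ?orbT.
- by rewrite U' subsetDl.
- by rewrite U'; apply: maximal_exhausted.
- have lU : live (valid I) w U K \subset U by apply/subsetP => p;
    rewrite in_set => /andP[].
  have cU : #|U| = #|mset n (m' 6)| + #|live (valid I) w U K|.
    by rewrite U' -(cardsID (live (valid I) w U K) U) (setIidPr lU) addnC.
  have cH : #|mset n (m' 1)| <= #|H| + #|K :\: free_steps I|.
    by rewrite H'; exact: leq_card_setU.
  have := leq_mul (leqnn d) cH; have := stable_cost stK.
  rewrite cU !mulnDr => le1 le2; apply: leq_trans (leq_add le2 (leqnn _)) _.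
  by rewrite -addnA leq_add2l addnC leq_add2l.
- move=> dn; rewrite H'; have -> : K :\: free_steps I = set0; last exact: setU0.
  apply/eqP; rewrite -subset0; apply/subsetP => e /loaded[p _ [_ dU]].
  have : #|U| <= n * n.
    by apply: leq_trans (max_card _) _; rewrite card_prod card_ord.
  lia.
Qed.

Lemma phase_partial m : partial m -> 0 < m 9 0 ->
  let m' := sem phase_prog m in
  [/\ partial m',
      forall w, exhausted (valid I) (free_steps I) (m 9 0) w (mset n (m' 6)),
      m 9 0 * #|mset n (m' 1)| + 2 * #|mset n (m' 6)| <=
      m 9 0 * #|mset n (m 1)| + 2 * #|mset n (m 6)|
    & n * n < m 9 0 -> mset n (m' 1) = mset n (m 1)].
Proof.
move=> pm d0 m'.
pose Inv (m1 : memory) := [/\ partial m1, m1 9 0 = m 9 0,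
  m 9 0 * #|mset n (m1 1)| + 2 * #|mset n (m1 6)| <=
      m 9 0 * #|mset n (m 1)| + 2 * #|mset n (m 6)|
  & n * n < m 9 0 -> mset n (m1 1) = mset n (m 1)].
pose Q k (m1 : memory) := forall w : 'I_n, w = k :> nat ->
  exhausted (valid I) (free_steps I) (m 9 0) w (mset n (m1 6)).
have [] := @for_all Inv Q 16 0 star_prog m.
- move=> x m1 [[sm HC UD cov] m9 le eqH].
  by split; rewrite ?update_other //; split; rewrite ?update_other //;
    apply: (static_agree (l := [:: 16])) sm => //; apply: agree_off_update.
- by move=> k x m1 q w wk; rewrite update_other //; exact: q.
- by split.
- have [[[-> _] _ _] _ _ _] := pm; rewrite input_size_n addn0.
  move=> k m1 kn mk [pm1 m9 le eqH].
  have := @star_partial m1 (Ordinal kn) pm1; rewrite m9 =>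
    /(_ d0 mk) [pm2 sub xh le2 eqH2].
  split.
  + split=> //; first by rewrite sem_frame.
      exact: leq_trans le2 le.
    by move=> dn; rewrite eqH2 // eqH.
  + by move=> w wk; rewrite (_ : w = Ordinal kn) //; exact: val_inj.
  + by move=> k' k'n q w wk; apply: (exhausted_sub sub); exact: q.
- have [[[-> _] _ _] _ _ _] := pm; rewrite input_size_n addn0.
  by move=> [pm' _ le eqH] q; split=> // w; exact: (q w).
Qed.

Lemma uncovered_bound m d H : partial m -> hopset 2 I H ->
  (forall w, exhausted (valid I) (free_steps I) d.+1 w (mset n (m 6))) ->
  #|mset n (m 6)| <= 2 * d * #|H|.
Proof.
move=> [_ _ UD _] hH xh; apply: (exhausted_bound xh) => p /(subsetP UD) pD.
have [w /and3P[mw h1 h2]] := hopset_midpoint hH pD.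
by exists w; rewrite /valid pD mw h1 h2.
Qed.

Lemma tables_partial m : m 0 = input I -> (forall a, a != 0 -> m a = fun=> 0) ->
  partial (sem tables_prog m).
Proof.
move=> m0 mz; have [|sm mD] := tables_spec lens m0; first by rewrite mz.
have H0 : mset n (sem tables_prog m 1) = set0.
  by rewrite sem_frame // mz //; apply/setP => e; rewrite !inE.
split=> //; first by rewrite H0 sub0set.
  by rewrite mD.
by move=> p pD; rewrite mD pD.
Qed.

Lemma count_spec m : m 0 0 = n -> m 9 0 = 0 ->
  sem count_prog m 9 0 = n.+1 * n.+1.
Proof.
move=> m0 m9; rewrite /count_prog; set s := Assign _ _ _.
pose P r (m1 : memory) := m1 0 0 = n /\ m1 9 0 = r.
have := @for_ind (fun r => P (r * n.+1)) 14 1 (For 15 1 s) m.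
rewrite m0 addn1 => h.
suff [] : P (n.+1 * n.+1) (sem (For 14 1 (For 15 1 s)) m) by [].
apply: h.
- by move=> r x m1 [a b]; split; rewrite update_other.
- by [].
- move=> r m1 rn mr [a b]; rewrite mulSn addnC.
  have := @for_ind (fun q => P (r * n.+1 + q)) 15 1 s m1.
  rewrite a addn1; apply.
  + by move=> q x m2 [a' b']; split; rewrite update_other.
  + by rewrite addn0.
  + move=> q m2 qn mq [a' b']; split; first by rewrite sem_assign update_other.
    by rewrite sem_assign [eval _ (Const 0)]/= update_same /= b' addn1 addnS.
Qed.

(** * Harmonic accounting over the thresholds *)

Local Open Scope ring_scope.

Variable R : realType.

Definition harmonic_sum k : R := \sum_(0 <= i < k) (i.+1%:R)^-1.

(** After [r] phases the last threshold was [(D - r).+1], and an uncovered demand is priced at 2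
    divided by it. The leading 1 on the right pays for the demands left by the first phase; each
    later phase adds one harmonic term. *)
Definition budget (D r : nat) (m : memory) := forall H, hopset 2 I H ->
  (#|mset n (m 6%N)| <= 2 * (D - r) * #|H|)%N /\
  #|mset n (m 1%N)|%:R + 2 * #|mset n (m 6%N)|%:R / (D - r).+1%:R <=
    4 * #|H|%:R * (1 + harmonic_sum D - harmonic_sum (D - r).+1) :> R.

Lemma phase_budget D r m : (n * n < D)%N -> (r < D)%N -> partial m ->
  m 9%N 0%N = (D - r)%N ->
  (if r == 0%N then mset n (m 1%N) = set0 else budget D r m) ->
  budget D r.+1 (sem phase_prog m).
Proof.
move=> nD rD pm m9 mb H hH.
have [|pm' xh le eqH] := phase_partial pm; first by rewrite m9 subn_gt0.
rewrite m9 in xh le eqH; set d := (D - r.+1)%N.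
have dE : (D - r = d.+1)%N by rewrite /d; lia.
rewrite dE in xh le eqH.
have u' := uncovered_bound pm' hH xh; split=> //.
set h' := #|mset n (sem phase_prog m 1%N)| in le *.
set u2 := #|mset n (sem phase_prog m 6%N)| in le u' *.
have opt0 : 0 <= #|H|%:R :> R by [].
have d0 : 0 < d.+1%:R :> R by [].
have u'R : u2%:R <= 2 * d%:R * #|H|%:R :> R by rewrite -!natrM ler_nat.
(* The first phase adds no step since D > n^2, so the bound on uncovered demands alone gives 2u / D
   <= 4 |H|. *)
move: mb; case: eqP => [r0 H0|_ mb].
  have D1 : d.+1 = D by rewrite -dE r0 subn0.
  have -> : h' = 0%N by rewrite /h' eqH ?H0 ?cards0 // D1.
  rewrite -D1 addrK mulr1 add0r ler_pdivrMr //.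
  have : d.+1%:R = d%:R + 1 :> R by rewrite -natr1.
  nra.
have [_] := mb H hH; rewrite dE.
set h := #|mset n (m 1%N)| in le *; set u := #|mset n (m 6%N)| in le *.
rewrite /harmonic_sum big_nat_recr //= -/(harmonic_sum d.+1) => mb'.
have [uo _] := mb H hH; rewrite dE in uo.
have uoR : u%:R <= 2 * d.+1%:R * #|H|%:R :> R by rewrite -!natrM ler_nat.
have leR : d.+1%:R * h'%:R + 2 * u2%:R <= d.+1%:R * h%:R + 2 * u%:R :> R.
  by rewrite -!natrM -!natrD ler_nat.
set a : R := d.+1%:R in d0 uoR leR *; set o : R := #|H|%:R in opt0 uoR mb' *.
have yE : d.+2%:R = a + 1 by rewrite -natr1.
rewrite yE in mb'; set x := a^-1; set y := (a + 1)^-1 in mb' *.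
have ax : a * x = 1 by rewrite mulfV // gt_eqF.
have x0 : 0 < x by rewrite invr_gt0.
have y0 : 0 < y by rewrite invr_gt0 addr_gt0.
have xy : x - y = x * y.
  have ay : (a + 1) * y = 1 by rewrite mulfV // gt_eqF // addr_gt0.
  transitivity (x * ((a + 1) * y) - a * x * y); last by ring.
  by rewrite ay ax mulr1 mul1r.
have le1 : h'%:R + 2 * u2%:R * x <= h%:R + 2 * u%:R * x.
  have := ler_wpM2r (ltW x0) leR; rewrite !mulrDl.
  by rewrite ![a * _ * x]mulrAC ax !mul1r.
(* Lowering the threshold from a + 1 to a raises the price of each of the u demands by 2 / (a(a +
   1)). With u <= 2a|H| this totals at most 4|H| / (a + 1), the new harmonic term. *)
have le2 : 2 * u%:R * (x * y) <= 4 * o * y.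
  have := ler_wpM2r (ltW (mulr_gt0 x0 y0)) uoR.
  have -> : 2 * a * o * (x * y) = 2 * o * y * (a * x) by ring.
  rewrite ax mulr1; lra.
rewrite -xy mulrBr in le2; apply: le_trans le1 _.
suff : 4 * o * (1 + harmonic_sum D - harmonic_sum d.+1) =
   4 * o * (1 + harmonic_sum D - (harmonic_sum d.+1 + y)) + 4 * o * y by lra.
by ring.
Qed.

Lemma main_spec m : m 0%N = input I ->
  (forall a, a != 0%N -> m a = fun=> 0%N) ->
  forall H, hopset 2 I H ->
  let m' := sem main_prog m in
  hopset 2 I (mset n (m' 1%N)) /\
  #|mset n (m' 1%N)|%:R <= 4 * harmonic_sum (n.+1 * n.+1) * #|H|%:R.
Proof.
move=> m0 mz H hH; rewrite /main_prog !sem_then.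
set D := (n.+1 * n.+1)%N; set s := Then _ _.
set m1 := sem tables_prog m; set m2 := sem count_prog m1.
have p1 : partial m1 by exact: tables_partial.
have partial_off l m3 m4 : all (fun a => a \notin l) [:: 0; 1; 2; 4; 5; 6]%N ->
    agree_off l m3 m4 -> partial m3 -> partial m4.
  move=> la ma [sm HC UD cov].
  have /= := la; case/and5P => l0 l1 l2 l4 /and3P[l5 l6 _].
  split; rewrite ?ma //; apply: static_agree ma sm.
  by rewrite /= l0 l2 l4 l5.
have p2 : partial m2.
  by apply: (partial_off [:: 14; 15; 9]%N) p1 => //; exact: agree_off_sem.
have z2 : m2 9%N 0%N = D.
  apply: count_spec; first by have [[[-> _] _ _] _ _ _] := p1.
  by rewrite /m1 sem_frame // mz.
have H2 : mset n (m2 1%N) = set0.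
  by apply/setP => e; rewrite /m2 sem_frame // /m1 sem_frame // mz // !inE.
pose P r (m3 : memory) := [/\ partial m3, m3 9%N 0%N = (D - r)%N &
  if r == 0%N then mset n (m3 1%N) = set0 else budget D r m3].
have Pk r k x m3 : k \in [:: 14; 15]%N -> P r m3 -> P r (update m3 k 0 x).
  move=> k1 [p3 m39 b3].
  have ak a : a \notin [:: 14; 15]%N -> a != k by apply: contraNneq => ->.
  split; rewrite /budget ?update_other ?ak //.
  by apply: (partial_off [:: 14; 15]%N) p3 => //; apply: agree_off_update.
suff [p3 z3 b3] : P D (sem (For 14 1 (For 15 1 s)) m2).
  (* The last threshold is 1, where the bound on uncovered demands is 0: all are served, and the
     first harmonic term cancels the extra 1. *)
  have [u0 h0] := b3 H hH.
  rewrite subnn muln0 leqn0 cards_eq0 in u0.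
  have [sm HC _ cov] := p3; split.
    by apply: midpoint_hopset => // p pD; apply: cov;
      rewrite // (eqP u0) in_set0.
  move: h0; rewrite (eqP u0) cards0 mulr0 mul0r addr0 subnn {2}/harmonic_sum.
  by rewrite big_nat1 invr1 addrAC subrr add0r mulrAC.
(* The two nested loops act as a single one, with flat index [r * n.+1 + q]. *)
have := @for_ind (fun r => P (r * n.+1)%N) 14 1 (For 15 1 s) m2.
have n1 m3 : partial m3 -> (m3 0 0 + 1 = n.+1)%N.
  by move=> [[[-> _] _ _] _ _ _]; rewrite input_size_n addn1.
rewrite n1 //; apply.
- by move=> r x m3; exact: Pk.
- by split; rewrite ?subn0.
- move=> r m3 rn mr Pr; rewrite mulSn addnC.
  have := @for_ind (fun q => P (r * n.+1 + q)%N) 15 1 s m3.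
  rewrite n1; last by case: Pr.
  apply; first by move=> q x m4; exact: Pk.
    by rewrite addn0.
  move=> q m4 qn mq [p4 m49 b4]; rewrite addnS.
  have rD : (r * n.+1 + q < D)%N by rewrite /D; nia.
  have nD : (n * n < D)%N by rewrite /D; nia.
  have [|p5 _ _ _] := phase_partial p4; first by rewrite m49 subn_gt0.
  have b5 := phase_budget nD rD p4 m49 b4.
  rewrite /s sem_then sem_assign; split.
  + by apply: (partial_off [:: 9]%N) p5 => //; apply: agree_off_update.
  + rewrite [eval _ (Const 0)]/= update_same.
    by rewrite -[eval _ _]/(sem phase_prog m4 9 0 - 1)%N sem_frame // m49; lia.
  + by rewrite /budget !update_other.
Qed.

End Main.

(** * Logarithmic growth of the ratio *)

Lemma harmonic_sum_le_ln (R : realType) k :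
  (harmonic_sum R k.+1 <= 1 + ln (k.+1%:R : R))%R.
Proof.
rewrite /harmonic_sum; elim: k => [|k IHk].
  by rewrite big_nat1 ln1 addr0 invr1.
rewrite big_nat_recr //=; apply: le_trans (lerD IHk (lexx _)) _.
rewrite -addrA lerD2l.
have k2 : (0 < k.+2%:R :> R)%R by [].
have E : (1 + - k.+2%:R^-1 = k.+1%:R / k.+2%:R :> R)%R.
  have k2n : (k.+2%:R != 0 :> R)%R by rewrite gt_eqF.
  apply: (mulIf k2n); rewrite divfK // mulrDl mul1r mulNr mulVf //.
  by rewrite -natr1 addrK.
(* From ln(1 + x) <= x at x = -1/(k+2) follows 1/(k+2) <= ln(k+2) - ln(k+1), and the sum
   telescopes. *)
have := @le_ln1Dx R (- k.+2%:R^-1)%R.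
rewrite E ln_div ?posrE // ltrN2 invf_lt1 // ltr1n => /(_ isT).
move: (ln _) (ln _) (_^-1)%R => a b c.
lra.
Qed.

Local Open Scope classical_set_scope.
Local Open Scope ring_scope.

Theorem theorem14 (R : realType) (lmax : {poly nat}) :
  exists (alpha : nat -> R) (prog : program),
    alpha =O_\oo (fun n : nat => ln (n%:R : R)) /\
    approximation_algorithm 2 lmax alpha prog.
Proof.
exists (fun n => 4 * harmonic_sum R (n.+1 * n.+1)), (compile main_prog); split.
  have l2 : 0 < ln (2 : R) by rewrite ln_gt0 // ltr1n.
  (* For n >= 2, (n+1)^2 <= n^4 bounds the ratio by 4 + 16 ln n, and 1 <= ln n / ln 2 absorbs the
     constant 4. *)
  apply/eqO_exP; exists (4 / ln 2 + 16); first by rewrite addr_gt0 // divr_gt0.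
  near=> n.
  have n2 : (2 <= n)%N by near: n; exact: nbhs_infty_ge.
  have n0 : 0 < n%:R :> R by rewrite ltr0n; lia.
  have ln2 : ln 2 <= ln (n%:R : R) by rewrite ler_ln ?posrE // ler_nat.
  have lnn : ln ((n.+1 * n.+1)%:R : R) <= 4 * ln (n%:R).
    rewrite mulr_natl -lnXn // ler_ln ?posrE ?exprn_gt0 // -natrX ler_nat.
    by rewrite !expnS expn0 muln1; nia.
  have harm := harmonic_sum_le_ln R (n * n + 2 * n).
  rewrite (_ : (n * n + 2 * n).+1 = n.+1 * n.+1)%N in harm; last lia.
  have h0 : 0 <= harmonic_sum R (n.+1 * n.+1).
    by apply: sumr_ge0 => i _; rewrite invr_ge0.
  rewrite ger0_norm ?mulr_ge0 // ger0_norm; last lra.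
  have : 1 <= ln (n%:R : R) / ln 2 by rewrite ler_pdivlMr // mul1r.
  rewrite (_ : _ * ln n%:R = 4 * (ln n%:R / ln 2) + 16 * ln n%:R); last by ring.
  lra.
exists (time main_prog) => n I lens.
set m0 := initial_memory (encode_instance I).
have [|t ex tle] := @exec_compile main_prog m0
  (input_size (encode_instance I)) isT.
  exact: size_encode.
exists t, (sem main_prog m0); split=> // Hopt [hH _].
by apply: (@main_spec n I lmax lens R m0) => // -[|a] // _.
Unshelve. all: by end_near.
Qed.
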